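(* For any $1\leq p_1,p_2<\infty$, the projective tensor product $\ell_{p_1}\widehat{\otimes}_\pi \ell_{p_2}$ is strongly weakly compactly generated (SWCG).
   Context: A Banach space $Z$ is strongly weakly compactly generated (SWCG) if there is a weakly compact set $G \subseteq Z$ such that for every weakly compact set $K \subseteq Z$ and every $\varepsilon>0$ there is $n\in \mathbb{N}$ such that $K \subseteq nG + \varepsilon B_Z$, where $B_Z$ is the closed unit ball of $Z$. $\widehat{\otimes}_\pi$ denotes the projective tensor product of Banach spaces. *)

(* Defs.v *)
From HB Require Import structures.
From mathcomp Require Import all_boot all_order all_algebra sesquilinear.
From mathcomp Require Import generic_quotient ring_quotient.
From mathcomp Require Import all_classical all_reals all_analysis.
From mathcomp Require Import ring.

Set Implicit Arguments.
Unset Strict Implicit.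
Unset Printing Implicit Defensive.

Import Order.TTheory GRing.Theory Num.Theory.
Import numFieldNormedType.Exports.

Local Open Scope classical_set_scope.
Local Open Scope ring_scope.
Local Open Scope quotient_scope.

Record seminorm (R : realType) (V : lmodType R) := Seminorm {
  seminorm_fun :> V -> R;
  seminormD : forall x y,
    seminorm_fun (x + y) <= seminorm_fun x + seminorm_fun y;
  seminormZ : forall a x, seminorm_fun (a *: x) = `|a| * seminorm_fun x
}.

Section seminorm_theory.
Context {R : realType} {V : lmodType R}.
Variable q : seminorm V.

Lemma seminorm0 : q 0 = 0.
Proof. by rewrite -(scale0r 0) seminormZ normr0 mul0r. Qed.

Lemma seminormN x : q (- x) = q x.
Proof. by rewrite -scaleN1r seminormZ normrN1 mul1r. Qed.

Lemma seminormB x y : q (x - y) = q (y - x).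
Proof. by rewrite -opprB seminormN. Qed.

Lemma seminorm_ge0 x : 0 <= q x.
Proof.
have := seminormD q x (- x); rewrite subrr seminorm0 seminormN -mulr2n.
by rewrite pmulrn_lge0.
Qed.

Lemma seminorm_dist x y : `|q x - q y| <= q (x - y).
Proof.
have H u v : q u - q v <= q (u - v).
  by rewrite lerBlDr -{1}(subrK v u) seminormD.
by rewrite ler_norml H andbT lerNl opprB seminormB H.
Qed.

Definition null_pred : {pred V} := [pred x | q x == 0].

Lemma null_submod_closed : submod_closed null_pred.
Proof.
split; first by rewrite inE seminorm0.
move=> a x y /[!inE] /eqP x0 /eqP y0; rewrite eq_le seminorm_ge0 andbT.
by rewrite (le_trans (seminormD _ _ _))// seminormZ x0 y0 mulr0 addr0.
Qed.

HB.instance Definition _ := GRing.isSubmodClosed.Build R V null_pred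
  null_submod_closed.

Definition seminorm_quot : Type := Quotient.quot null_pred.
HB.instance Definition _ := GRing.Zmodule.on seminorm_quot.

Definition sep_class (x : V) : seminorm_quot := \pi_(Quotient.quot null_pred) x.
Definition sep_repr (z : seminorm_quot) : V := repr (z : Quotient.quot null_pred).
Definition sep_norm (z : seminorm_quot) : R := q (sep_repr z).
Definition sep_scale (a : R) (z : seminorm_quot) : seminorm_quot :=
  sep_class (a *: sep_repr z).

Lemma sep_reprK z : sep_class (sep_repr z) = z.
Proof. exact: reprK. Qed.

Lemma sep_classP x y : sep_class x = sep_class y <-> q (x - y) = 0.
Proof.
have E : (x - y \in null_pred) = (q (x - y) == 0) by [].
split=> [xy|/eqP]; first by apply/eqP; rewrite -E Quotient.idealrBE; apply/eqP.
by rewrite -E Quotient.idealrBE => /eqP.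
Qed.

Lemma sep_classD x y : sep_class (x + y) = sep_class x + sep_class y.
Proof. by rewrite /sep_class !piE. Qed.

Lemma sep_classN x : sep_class (- x) = - sep_class x.
Proof. by rewrite /sep_class !piE. Qed.

Lemma sep_normE x : sep_norm (sep_class x) = q x.
Proof.
apply/eqP; rewrite -subr_eq0 -normr_le0 (le_trans (seminorm_dist _ _))//.
by have /sep_classP -> := sep_reprK (sep_class x).
Qed.

Lemma sep_scaleE a x : sep_scale a (sep_class x) = sep_class (a *: x).
Proof.
apply/sep_classP; rewrite -scalerBr seminormZ.
by have /sep_classP -> := sep_reprK (sep_class x); rewrite mulr0.
Qed.

Lemma sep_scaleA a b z : sep_scale a (sep_scale b z) = sep_scale (a * b) z.
Proof. by rewrite -(sep_reprK z) !sep_scaleE scalerA. Qed.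

Lemma sep_scale1 : left_id 1 sep_scale.
Proof. by move=> z; rewrite -(sep_reprK z) sep_scaleE scale1r. Qed.

Lemma sep_scaleDr : right_distributive sep_scale +%R.
Proof.
move=> a y z; rewrite -(sep_reprK y) -(sep_reprK z).
by rewrite -sep_classD !sep_scaleE scalerDr sep_classD.
Qed.

Lemma sep_scaleDl z : {morph sep_scale^~ z : a b / a + b}.
Proof.
by move=> a b; rewrite -(sep_reprK z) !sep_scaleE scalerDl sep_classD.
Qed.

HB.instance Definition _ := GRing.Zmodule_isLmodule.Build R seminorm_quot
  sep_scaleA sep_scale1 sep_scaleDr sep_scaleDl.

Lemma sep_classZ a x : sep_class (a *: x) = a *: sep_class x.
Proof. by rewrite -sep_scaleE. Qed.

Lemma sep_normD y z : sep_norm (y + z) <= sep_norm y + sep_norm z.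
Proof.
rewrite -(sep_reprK y) -(sep_reprK z) -sep_classD !sep_normE.
exact: seminormD.
Qed.

Lemma sep_normZ a z : sep_norm (a *: z) = `|a| * sep_norm z.
Proof. by rewrite -(sep_reprK z) -sep_classZ !sep_normE seminormZ. Qed.

Lemma sep_norm_eq0 z : sep_norm z = 0 -> z = 0.
Proof.
rewrite -(sep_reprK z) sep_normE => z0.
have -> : 0 = sep_class 0 by rewrite /sep_class !piE.
by apply/sep_classP; rewrite subr0.
Qed.

HB.instance Definition _ := Lmodule_isNormed.Build R seminorm_quot
  sep_normD sep_normZ sep_norm_eq0.

Lemma norm_sep_class x : `|sep_class x| = q x.
Proof. exact: sep_normE. Qed.

End seminorm_theory.

(* The completion consists of Cauchy sequences modulo sequences tending to 0 in
   seminorm. The quotient also identifies vectors at distance 0, so no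
   separation hypothesis on the seminorm is needed. *)

Definition cauchy_seq (R : realType) (V : lmodType R) (q : seminorm V)
    (u : nat -> V) : Prop :=
  forall e : R, 0 < e ->
    exists N, forall m n, (N <= m)%N -> (N <= n)%N -> q (u m - u n) < e.

Definition cauchy_pred (R : realType) (V : lmodType R) (q : seminorm V) :
  {pred nat -> V} := [pred u | `[< cauchy_seq q u >]].

Record cauchy_sequence (R : realType) (V : lmodType R) (q : seminorm V) :=
  CauchySequence { cseq :> nat -> V; _ : cseq \in cauchy_pred q }.

Section completion.
Context {R : realType} {V : lmodType R}.
Variable q : seminorm V.

Lemma cauchy_submod_closed : submod_closed (cauchy_pred q).
Proof.
split.
  apply/asboolP => e e0; exists 0%N => m n _ _.
  by rewrite subrr seminorm0.
move=> a u v /asboolP qu /asboolP qv; apply/asboolP => e e0.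
have a1 : 0 < `|a| + 1 by rewrite ltr_wpDl.
have [N HN] := qu (e / 2 / (`|a| + 1)) (divr_gt0 (divr_gt0 e0 (ltr0Sn R 1)) a1).
have [M HM] := qv (e / 2) (divr_gt0 e0 (ltr0Sn R 1)).
exists (maxn N M) => m n; rewrite !geq_max => /andP[Nm Mm] /andP[Nn Mn].
have -> : (a *: u + v) m - (a *: u + v) n =
          a *: (u m - u n) + (v m - v n).
  by rewrite !fctE scalerBr opprD addrACA.
rewrite (le_lt_trans (seminormD _ _ _))// seminormZ.
rewrite [ltRHS](splitr e) ltr_leD// ?(ltW (HM _ _ _ _))//.
have := HN _ _ Nm Nn; rewrite ltr_pdivlMr// => /(le_lt_trans _); apply.
by rewrite mulrC ler_wpM2l ?seminorm_ge0// lerDl.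
Qed.

HB.instance Definition _ := GRing.isSubmodClosed.Build R (nat -> V)
  (cauchy_pred q) cauchy_submod_closed.

HB.instance Definition _ := [isSub for @cseq R V q].
HB.instance Definition _ := [Choice of cauchy_sequence q by <:].
HB.instance Definition _ :=
  [SubChoice_isSubLmodule of cauchy_sequence q by <:].

Lemma cseqP (u : cauchy_sequence q) : cauchy_seq q u.
Proof. by case: u => u /= /asboolP. Qed.

Lemma cseq_norm_cvg (u : cauchy_sequence q) : cvgn (fun n => q (u n)).
Proof.
apply/cauchy_cvgP/cauchyP => e e0; have [N HN] := cseqP u e0.
exists (q (u N)), N => // n /= Nn.
by rewrite /ball/= (le_lt_trans (seminorm_dist _ _ _))// HN.
Qed.

Definition lim_norm (u : cauchy_sequence q) : R := limn (fun n => q (u n)).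

Lemma lim_normD u v : lim_norm (u + v) <= lim_norm u + lim_norm v.
Proof.
rewrite -limD; [|exact: cseq_norm_cvg..].
apply: ler_lim; [exact: cseq_norm_cvg|apply: is_cvgD; exact: cseq_norm_cvg|].
by apply: nearW => n; exact: seminormD.
Qed.

Lemma lim_normZ a u : lim_norm (a *: u) = `|a| * lim_norm u.
Proof.
apply: cvg_lim => //.
have -> : (fun n => q ((a *: u) n)) = (fun n => `|a| * q (u n)).
  by apply/funext => n; exact: seminormZ.
by apply: cvgM; [exact: cvg_cst|exact: cseq_norm_cvg].
Qed.

Definition lim_seminorm : seminorm (cauchy_sequence q) :=
  Seminorm lim_normD lim_normZ.

Definition completion : Type := seminorm_quot lim_seminorm.
HB.instance Definition _ := NormedModule.on completion.

Lemma cst_cauchy (x : V) : (fun=> x) \in cauchy_pred q.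
Proof.
by apply/asboolP => e e0; exists 0%N => m n _ _; rewrite subrr seminorm0.
Qed.

Definition to_completion (x : V) : completion :=
  sep_class lim_seminorm (CauchySequence (cst_cauchy x)).

Lemma to_completion_is_linear : linear to_completion.
Proof.
move=> a x y; rewrite /to_completion -sep_classZ -sep_classD.
by congr (sep_class _ _); apply/val_inj/funext.
Qed.

HB.instance Definition _ :=
  GRing.isLinear.Build R V completion _ to_completion to_completion_is_linear.

Lemma norm_to_completion x : `|to_completion x| = q x.
Proof. by rewrite norm_sep_class /= /lim_norm /= lim_cst. Qed.

Lemma completion_approx (u : cauchy_sequence q) e N :
  (forall m n, (N <= m)%N -> (N <= n)%N -> q (u m - u n) < e) ->
  forall n, (N <= n)%N ->
    `|(sep_class lim_seminorm u : completion) - to_completion (u n)| <= e.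
Proof.
move=> HN n Nn; rewrite /to_completion -sep_classN -sep_classD norm_sep_class.
apply: limr_le; first exact: cseq_norm_cvg.
by exists N => // m /= Nm; apply/ltW/HN.
Qed.

Lemma to_completion_dense (z : completion) (e : R) :
  0 < e -> exists x, `|z - to_completion x| < e.
Proof.
move=> e0; have e20 : 0 < e / 2 by rewrite divr_gt0.
have [N HN] := cseqP (sep_repr z) e20.
exists (sep_repr z N); rewrite -{1}(sep_reprK z).
rewrite (le_lt_trans (completion_approx HN (leqnn N)))//.
by rewrite gtr_pMr// invf_lt1 ?ltr1n.
Qed.

Lemma completion_complete (F : set_system completion) :
  ProperFilter F -> cauchy F -> cvg F.
Proof.
move=> PF /cauchyP cF.
have inv_gt0 n : 0 < (n.+1%:R : R)^-1 by rewrite invr_gt0.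
have /choice[z Fz] n : exists z, F (ball z (n.+1%:R^-1 : R)).
  by have [z] := cF _ (inv_gt0 n); exists z.
have /choice[v zv] n : exists x, `|z n - to_completion x| < n.+1%:R^-1.
  exact: to_completion_dense.
have zz m n : `|z m - z n| < m.+1%:R^-1 + n.+1%:R^-1.
  have [w []] := filter_ex (filterI (Fz m) (Fz n)).
  rewrite -!ball_normE /= => mw nw.
  rewrite -(subrKA w) (le_lt_trans (ler_normD _ _))// ltrD//.
  by rewrite distrC.
have inv_lt (e : R) : 0 < e -> exists N, forall n, (N <= n)%N -> n.+1%:R^-1 < e.
  move=> e0; have [N _ HN] := near_infty_natSinv_lt (PosNum e0).
  by exists N => n Nn; exact: HN.
have vv m n : q (v m - v n) < (m.+1%:R^-1 + n.+1%:R^-1) *+ 2.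
  rewrite -norm_to_completion linearB/=.
  rewrite -(subrKA (z m)) (le_lt_trans (ler_normD _ _))//.
  rewrite mulr2n -addrA ltrD// ?(distrC _ (z m))//.
  rewrite -(subrKA (z n)) (le_lt_trans (ler_normD _ _))//.
  by rewrite addrC ltrD.
have vC : v \in cauchy_pred q.
  apply/asboolP => e e0; have e40 : 0 < e / 4 by rewrite divr_gt0.
  have [N HN] := inv_lt _ e40.
  exists N => m n Nm Nn; rewrite (lt_trans (vv m n))//.
  have -> : e = (e / 4 + e / 4) *+ 2 by field.
  by rewrite ltrMn2r// ltrD// HN.
pose l : completion := sep_class lim_seminorm (CauchySequence vC).
apply/cvg_ex; exists l; apply/cvgrPdist_lt => e e0.
have e30 : 0 < e / 3 by rewrite divr_gt0.
have [N HN] := inv_lt _ e30.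
have [M HM] := cseqP (CauchySequence vC) e30.
pose k := maxn N M.
have := Fz k; apply: filterS => w; rewrite -ball_normE /= => kw.
have Nk : k.+1%:R^-1 < e / 3 by apply: HN; rewrite leq_maxl.
have lk := completion_approx HM (leq_maxr N M : (M <= k)%N).
have -> : e = e / 3 + (e / 3 + e / 3) by field.
rewrite -(subrKA (to_completion (v k))) (le_lt_trans (ler_normD _ _))//.
rewrite ler_ltD// -(subrKA (z k)) (le_lt_trans (ler_normD _ _))// ltrD//.
  by rewrite distrC (lt_trans (zv k)).
exact: lt_trans Nk.
Qed.

HB.instance Definition _ :=
  Uniform_isComplete.Build completion completion_complete.

End completion.

(* The algebraic tensor product of X and Y is the space of linear functionals
   on the bilinear forms on X * Y spanned by the evaluations B |-> B x y
   (R. Ryan, Introduction to Tensor Products of Banach Spaces, Section 1.1);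
   no continuity is required of the forms. *)

Local Notation bilform R X Y :=
  {bilinear X%type -> Y%type -> R%type | *%R & *%R}.

Definition tensor_sum (R : realType) (X Y : lmodType R) (s : seq (X * Y)) :
    bilform R X Y -> R :=
  fun B => \sum_(xy <- s) B xy.1 xy.2.

Definition tensor_pred (R : realType) (X Y : lmodType R) :
    {pred bilform R X Y -> R} :=
  [pred t | `[< exists s : seq (X * Y), t = tensor_sum s >]].

Record tensor (R : realType) (X Y : lmodType R) := Tensor {
  tensor_eval :> bilform R X Y -> R;
  _ : tensor_eval \in @tensor_pred R X Y
}.

Section tensor.
Context {R : realType} {X Y : lmodType R}.
Implicit Types (s : seq (X * Y)).

Lemma tensor_sum_cat s s' :
  tensor_sum (s ++ s') = tensor_sum s + tensor_sum s'.
Proof. by apply/funext => B; rewrite /tensor_sum big_cat. Qed.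

Lemma tensor_sum_scale a s :
  tensor_sum [seq (a *: xy.1, xy.2) | xy <- s] = a *: tensor_sum s.
Proof.
apply/funext => B; rewrite fctE /tensor_sum big_map scaler_sumr.
by apply: eq_bigr => xy _; exact: linearZl_LR.
Qed.

Lemma tensor_submod_closed : submod_closed (@tensor_pred R X Y).
Proof.
split.
  by apply/asboolP; exists [::]; apply/funext => B; rewrite /tensor_sum big_nil.
move=> a t u /asboolP[s ->] /asboolP[s' ->]; apply/asboolP.
by exists ([seq (a *: xy.1, xy.2) | xy <- s] ++ s');
  rewrite tensor_sum_cat tensor_sum_scale.
Qed.

HB.instance Definition _ := GRing.isSubmodClosed.Build R (bilform R X Y -> R)
  (@tensor_pred R X Y) tensor_submod_closed.

HB.instance Definition _ := [isSub for @tensor_eval R X Y].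
HB.instance Definition _ := [Choice of tensor X Y by <:].
HB.instance Definition _ := [SubChoice_isSubLmodule of tensor X Y by <:].

Lemma tensorP (t : tensor X Y) : exists s, tensor_eval t = tensor_sum s.
Proof. by case: t => t /= /asboolP. Qed.

Lemma tens_subproof (x : X) (y : Y) :
  tensor_sum [:: (x, y)] \in @tensor_pred R X Y.
Proof. by apply/asboolP; exists [:: (x, y)]. Qed.

Definition tens (x : X) (y : Y) : tensor X Y := Tensor (tens_subproof x y).

Lemma tens_bilinear : bilinear_for
  (GRing.scale : GRing.Scale.law R (tensor X Y))
  (GRing.scale : GRing.Scale.law R (tensor X Y)) tens.
Proof.
split=> [y a x x'|x a y y']; apply/val_inj/funext => B;
  rewrite /= /tensor_sum !fctE !big_seq1 /=.
- by rewrite linearDl linearZl_LR.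
- by rewrite linearDr linearZr.
Qed.

Lemma tens_sumE s : tensor_eval (\sum_(xy <- s) tens xy.1 xy.2) = tensor_sum s.
Proof.
elim: s => [|[x y] s IH].
  by rewrite big_nil; apply/funext => B; rewrite /tensor_sum big_nil.
by rewrite big_cons -cat1s tensor_sum_cat -IH.
Qed.

Lemma tensor_eqP (t : tensor X Y) s :
  t = \sum_(xy <- s) tens xy.1 xy.2 <-> tensor_eval t = tensor_sum s.
Proof. by rewrite -tens_sumE; split=> [->//|/val_inj]. Qed.

End tensor.

Section projective_tensor.
Context {R : realType} {X Y : normedModType R}.

Definition cost (s : seq (X * Y)) : R := \sum_(xy <- s) `|xy.1| * `|xy.2|.

Definition projective_norm (t : tensor X Y) : R :=
  inf [set cost s | s in [set s | t = \sum_(xy <- s) tens xy.1 xy.2]].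

Lemma cost_ge0 s : 0 <= cost s.
Proof. by apply: sumr_ge0 => xy _; rewrite mulr_ge0. Qed.

Lemma projective_norm_has_inf (t : tensor X Y) :
  has_inf [set cost s | s in [set s | t = \sum_(xy <- s) tens xy.1 xy.2]].
Proof.
split; last by exists 0 => _ [s _ <-]; exact: cost_ge0.
by have [s /tensor_eqP ts] := tensorP t; exists (cost s), s.
Qed.

Lemma projective_norm_ge0 t : 0 <= projective_norm t.
Proof.
apply: lb_le_inf; first by have [] := projective_norm_has_inf t.
by move=> _ [s _ <-]; exact: cost_ge0.
Qed.

Lemma projective_norm_le_cost t s :
  t = \sum_(xy <- s) tens xy.1 xy.2 -> projective_norm t <= cost s.
Proof.
move=> ts; apply: ge_inf; last by exists s.
by have [] := projective_norm_has_inf t.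
Qed.

Lemma projective_norm_approx t (e : R) : 0 < e ->
  exists2 s, t = \sum_(xy <- s) tens xy.1 xy.2 & cost s < projective_norm t + e.
Proof.
move=> e0; have [_ [s ts <-] H] := inf_adherent e0 (projective_norm_has_inf t).
by exists s.
Qed.

Lemma projective_normD t u :
  projective_norm (t + u) <= projective_norm t + projective_norm u.
Proof.
apply/ler_addgt0Pr => e e0; have e20 : 0 < e / 2 by rewrite divr_gt0.
have [s ts sl] := projective_norm_approx t e20.
have [s' us' s'l] := projective_norm_approx u e20.
have tu : t + u = \sum_(xy <- s ++ s') tens xy.1 xy.2.
  by rewrite big_cat -ts -us'.
rewrite (le_trans (projective_norm_le_cost tu))// /cost big_cat /=.
by rewrite (splitr e) addrACA lerD ?ltW.
Qed.

Lemma projective_normZ_le a t :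
  projective_norm (a *: t) <= `|a| * projective_norm t.
Proof.
apply/ler_addgt0Pr => e e0.
have a1 : 0 < `|a| + 1 by rewrite ltr_wpDl.
have [s /tensor_eqP ts sl] := projective_norm_approx t (divr_gt0 e0 a1).
have ats : a *: t = \sum_(xy <- [seq (a *: xy.1, xy.2) | xy <- s]) tens xy.1 xy.2.
  by apply/tensor_eqP; rewrite tensor_sum_scale -ts.
rewrite (le_trans (projective_norm_le_cost ats))// /cost big_map /=.
under eq_bigr do rewrite normrZ -mulrA.
rewrite -mulr_sumr (le_trans (ler_wpM2l _ (ltW sl)))// mulrDr lerD2l.
by rewrite mulrA ler_pdivrMr// mulrC ler_wpM2l ?(ltW e0)// lerDl.
Qed.

Lemma projective_normZ a t :
  projective_norm (a *: t) = `|a| * projective_norm t.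
Proof.
apply/eqP; rewrite eq_le projective_normZ_le/=.
have [->|a0] := eqVneq a 0.
  by rewrite normr0 mul0r projective_norm_ge0.
rewrite -{1}(scalerK a0 t) -ler_pdivlMl ?normr_gt0//.
by rewrite -normfV projective_normZ_le.
Qed.

Definition projective_seminorm : seminorm (tensor X Y) :=
  Seminorm projective_normD projective_normZ.

End projective_tensor.

Definition projective_tensor (R : realType) (X Y : normedModType R) : Type :=
  completion (@projective_seminorm R X Y).

HB.instance Definition _ (R : realType) (X Y : normedModType R) :=
  CompleteNormedModule.on (projective_tensor X Y).

Definition ellp (R : realType) (p : R) (p1 : 1 <= p) : Type :=
  LfunType (counting : {measure set nat -> \bar R}) (p1 : (1 <= p%:E)%E).

Section ellp.
Context {R : realType} {p : R} (p1 : 1 <= p).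
Local Notation mu := (counting : {measure set nat -> \bar R}).

HB.instance Definition _ := GRing.Lmodule.on (ellp p1).

Definition ellp_norm (x : ellp p1) : R :=
  fine ('N[mu]_p%:E[EFin \o (x : nat -> R)])%E.

Lemma ellp_normD x y : ellp_norm (x + y) <= ellp_norm x + ellp_norm y.
Proof. exact: ler_LnormD. Qed.

Lemma ellp_normZ a x : ellp_norm (a *: x) = `|a| * ellp_norm x.
Proof.
apply/EFin_inj; rewrite EFinM /ellp_norm !finite_norm_fine.
exact: LnormZ.
Qed.

Lemma ellp_normEsum (x : ellp p1) :
  (ellp_norm x)%:E = ((\sum_(k <oo) (`|(x : nat -> R) k| `^ p)%:E) `^ p^-1)%E.
Proof.
rewrite /ellp_norm finite_norm_fine unlock /Lnorm ge0_integral_count//.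
by move=> k; rewrite lee_fin powR_ge0.
Qed.

Lemma ellp_norm_eq0 x : ellp_norm x = 0 -> x = 0.
Proof.
move=> x0; have := ellp_normEsum x; rewrite x0 => /esym/poweR_eq0_eq0.
have x_ge0 k : (0 <= (`|(x : nat -> R) k| `^ p)%:E)%E.
  by rewrite lee_fin powR_ge0.
move=> /(_ (nneseries_ge0 (fun k _ _ => x_ge0 k))) sum0.
apply/LfuneqP => k; apply/eqP; rewrite -normr_eq0; apply/eqP.
apply: (@powR_eq0_eq0 _ _ p); apply/EFin_inj.
have /eqP := sum0; rewrite (nneseriesD1 (n := k))//.
rewrite padde_eq0 ?nneseries_ge0//. by move=> /andP[/eqP].
Qed.

HB.instance Definition _ := Lmodule_isNormed.Build R (ellp p1)
  ellp_normD ellp_normZ ellp_norm_eq0.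

End ellp.

Lemma ellp_memE (R : realType) (p : R) (p1 : 1 <= p) (u : nat -> R) :
  (u \in Lfun (counting : {measure set nat -> \bar R}) p%:E) =
  (\sum_(k <oo) (`|u k| `^ p)%:E < +oo)%E.
Proof.
have p0 : 0 < p by exact: lt_le_trans p1.
have -> : (\sum_(k <oo) (`|u k| `^ p)%:E)%E =
  (\int[(counting : {measure set nat -> \bar R})]_k (`|(u k)%:E| `^ p))%E.
  by rewrite ge0_integral_count// => k; rewrite lee_fin powR_ge0.
apply/idP/idP => [/andP[_]|fin].
  rewrite inE/= /finite_norm unlock => /lty_poweRy; apply.
  by rewrite invr_neq0// gt_eqF.
apply/andP; split; rewrite inE//=.
by rewrite /finite_norm unlock poweR_lty.
Qed.

Record continuous_dual (R : realType) (Z : normedModType R) := ContinuousDual {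
  dual_fun :> {scalar Z};
  _ : continuous dual_fun
}.

Definition weak_topology (R : realType) (Z : normedModType R) : Type :=
  initial_topology
    ((fun z f => f z) : Z -> {ptws continuous_dual Z -> R}).

HB.instance Definition _ (R : realType) (Z : normedModType R) :=
  Topological.on (weak_topology Z).

Lemma weak_cvgP (R : realType) (Z : normedModType R)
    (F : set_system Z) (z : Z) : Filter F ->
  ((F : set_system (weak_topology Z)) --> (z : weak_topology Z)) <->
  (forall f : continuous_dual Z, f x @[x --> F] --> f z).
Proof.
move=> FF; pose ev := (fun z f => f z) : Z -> {ptws continuous_dual Z -> R}.
have evc : continuous (ev : weak_topology Z -> _) by exact: initial_continuous.
split=> [Fz f|Fz].
  have /cvg_sup/(_ f) evF : ev @ F --> ev z.
    exact: cvg_trans (cvg_app ev Fz) (evc z).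
  have fc := @initial_continuous _ _
    (fun g : continuous_dual Z -> R => g f) (ev z).
  exact: cvg_trans (cvg_app _ evF) fc.
have evF : ev @ F --> ev z.
  apply/cvg_sup => f A; rewrite nbhsE => -[_ [[B oB <-] Bfz] BA].
  apply: filterS BA _; apply: (Fz f); exact: open_nbhs_nbhs.
move=> A; rewrite nbhsE => -[_ [[B oB <-] Bz] BA].
by apply: filterS BA _; apply: evF; exact: open_nbhs_nbhs.
Qed.

Definition weakly_compact (R : realType) (Z : normedModType R) (K : set Z) :=
  compact (K : set (weak_topology Z)).

Definition SWCG (R : realType) (Z : completeNormedModType R) : Prop :=
  exists2 G : set Z, weakly_compact G &
    forall K : set Z, weakly_compact K -> forall e : R, 0 < e ->
      exists n : nat,
        K `<=` [set n%:R *: g + e *: b | g in G & b in [set b : Z | `|b| <= 1]].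

(* Main.v *)
Require Import Defs.
From HB Require Import structures.
From mathcomp Require Import all_boot all_order all_algebra sesquilinear.
From mathcomp Require Import all_classical all_reals all_analysis.
From mathcomp Require Import ring lra.

(** Elements of the tensor product Z of l_p and l_q are infinite matrices. Let P_n be
    the projection of l_p or l_q onto the first n coordinates and Q_n = 1 - P_n.

    It suffices (SWCG_of_projections) to find uniformly bounded projections A_m of Z
    such that the balls of the ranges of the A_m are weakly compact, and such that
    z - A_m z becomes uniformly small on every weakly compact set. Indeed, balls of
    radius tending to 0 in these ranges form together one weakly compact set G, and
    the image under A_m of a weakly compact set, which is bounded, lies in a multiple
    of G. The choice of A_m depends on the exponents.

    - If 1/p + 1/q < 1, the whole ball of Z is weakly compact, and A_m = 1.

    - If 1/p + 1/q >= 1, then for disjoint blocks D_k = P_(m_k) Q_(n_k) the sum of the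
      norms of D_k z D_k is at most 2 |z|: on elementary tensors this is a weak form
      of Hoelder's inequality (segXY_sum). So Z looks like l_1 along the diagonal, and
      the gliding hump that proves the Schur property of l_1
      (weakly_compact_small_tails) shows that Q_m z Q_m tends to 0 uniformly on weakly
      compact sets. Hence A_m z = z - Q_m z Q_m will do, if p and q are larger than 1:
      its range consists of m rows and m columns, copies of l_q and l_p.

    - If p = 1, the same argument applies to the row blocks D_k z, and if q = 1 to
      the column blocks z D_k. So A_m z can be P_m z, z P_m, or P_m z P_m.

    The weak compactness of the balls (weakly_compact_fixed_ball) rests on two facts.
    First, Z is boundedly complete (bounded_complete): bounded compatible matrices of
    growing size n x n converge in Z. The reason is that the norms of k disjoint
    blocks z D_i of a single z sum to o(k) only, as q is finite; likewise for rows.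
    Second, every functional f on Z is nearly determined, on the range of A_m, by a
    finite corner. For a single row or column this is the fact that functionals on
    l_q are small on far tails if q > 1 (functional_tail_small). If
    1/p + 1/q < 1, the form f itself is small on pairs of far tails, as in Pitt's
    theorem (functional_corner_tail_small). Both are contradictions between k e and
    the power of k that bounds the norm of a sum of k disjoint unit vectors.

    Norming functionals come from the Hahn-Banach theorem, proved here with minimal
    sublinear functions. About l_p only the additivity of the p-th powers of the norms
    of head and tail and the density of finite sequences are used (lp_basis). *)

Set Implicit Arguments.
Unset Strict Implicit.
Unset Printing Implicit Defensive.

Import Order.TTheory GRing.Theory Num.Theory.
Import numFieldNormedType.Exports.

Local Open Scope classical_set_scope.
Local Open Scope ring_scope.

(** * Norming functionals *)

(** Only the inequality p (t x) <= t p x is required, because this form passes to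
    infima; the equality is a consequence (sublinearZ). *)
Definition sublinear (R : realType) (V : lmodType R) (p : V -> R) : Prop :=
  (forall x y, p (x + y) <= p x + p y) /\
  (forall t x, 0 < t -> p (t *: x) <= t * p x).

Section hahn_banach.
Context {R : realType} {V : lmodType R}.
Implicit Types (p q : V -> R) (x y : V).

Lemma sublinear0 p : sublinear p -> p 0 = 0.
Proof.
move=> [_ pZ]; have := pZ 2 0 (ltr0Sn R 1).
by have := pZ (2^-1) 0; rewrite !scaler0 invr_gt0 => /(_ (ltr0Sn R 1)); lra.
Qed.

Lemma sublinearZ p t x : sublinear p -> 0 <= t -> p (t *: x) = t * p x.
Proof.
move=> sp; rewrite le_eqVlt => /predU1P[<-|t0].
  by rewrite scale0r mul0r sublinear0.
have [_ pZ] := sp; apply/eqP; rewrite eq_le pZ//= -ler_pdivlMl//.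
by have := pZ t^-1 (t *: x); rewrite scalerK ?gt_eqF// invr_gt0; apply.
Qed.

Lemma sublinear_geN p x : sublinear p -> - p (- x) <= p x.
Proof.
by move=> sp; have := sp.1 x (- x); rewrite subrr sublinear0//; lra.
Qed.

Lemma sublinear_chain_inf (A : set (V -> R)) : A !=set0 ->
  (forall p, A p -> sublinear p) ->
  (forall p q, A p -> A q -> (forall x, p x <= q x) \/ (forall x, q x <= p x)) ->
  exists2 q, sublinear q & forall p, A p -> forall x, q x <= p x.
Proof.
move=> [p0 Ap0] Asub Atot.
have lbA x : has_lbound [set p x | p in A].
  exists (- p0 (- x)) => _ [p Ap <-].
  have [pp0|p0p] := Atot _ _ Ap Ap0.
    by rewrite (le_trans _ (sublinear_geN x (Asub _ Ap)))// lerN2.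
  by rewrite (le_trans (sublinear_geN x (Asub _ Ap0))).
have neA x : [set p x | p in A] !=set0 by exists (p0 x), p0.
pose q x := inf [set p x | p in A].
have qle p x : A p -> q x <= p x by move=> Ap; apply: ge_inf => //; exists p.
exists q; last by move=> p Ap x; exact: qle.
split=> [x y|t x t0].
  rewrite -lerBlDr; apply: lb_le_inf => // _ [p Ap <-].
  rewrite lerBlDr -lerBlDl; apply: lb_le_inf => // _ [r Ar <-].
  rewrite lerBlDl; have [pr|rp] := Atot _ _ Ap Ar.
    by rewrite (le_trans (qle p _ Ap))// (le_trans ((Asub _ Ap).1 _ _))// lerD2l.
  by rewrite (le_trans (qle r _ Ar))// (le_trans ((Asub _ Ar).1 _ _))// lerD2r.
rewrite -ler_pdivrMl//; apply: lb_le_inf => // _ [p Ap <-].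
by rewrite ler_pdivrMl// (le_trans (qle p _ Ap))//; apply: (Asub _ Ap).2.
Qed.

(** The infimum over t >= 0 of p (x + t y) - t p y. It lies below p and takes the
    value - p y at - y, so every linear functional below it takes at y the value
    p y. It also lets a minimal sublinear function be compared with itself. *)
Lemma sublinear_shift p y : sublinear p ->
  exists2 q, sublinear q & forall t x, 0 <= t -> q x <= p (x + t *: y) - t * p y.
Proof.
move=> sp; have [pD pZ] := sp.
pose S x := [set p (x + t *: y) - t * p y | t in [set t | 0 <= t]].
have lbS x : has_lbound (S x).
  exists (- p (- x)) => _ [t /= t0 <-].
  have := pD (x + t *: y) (- x); rewrite addrAC subrr add0r.
  by rewrite (sublinearZ _ sp)//; lra.
have neS x : S x !=set0 by exists (p (x + 0 *: y) - 0 * p y), 0 => /=.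
pose q x := inf (S x).
have qle t x : 0 <= t -> q x <= p (x + t *: y) - t * p y.
  by move=> t0; apply: ge_inf => //; exists t.
exists q; last by move=> t x; exact: qle.
split=> [x z|t x t0].
  rewrite -lerBlDr; apply: lb_le_inf => // _ [t /= t0 <-].
  rewrite lerBlDr -lerBlDl; apply: lb_le_inf => // _ [u /= u0 <-].
  rewrite lerBlDl; have := qle (t + u) (x + z) (addr_ge0 t0 u0).
  have := pD (x + t *: y) (z + u *: y).
  by rewrite addrACA -scalerDl; lra.
rewrite -ler_pdivrMl//; apply: lb_le_inf => // _ [u /= u0 <-].
rewrite ler_pdivrMl//; have := qle (t * u) (t *: x) (mulr_ge0 (ltW t0) u0).
have := pZ t (x + u *: y) t0; rewrite scalerDr scalerA; lra.
Qed.

Lemma minimal_sublinear p0 : sublinear p0 -> exists2 p, sublinear p &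
  (forall x, p x <= p0 x) /\
  forall q, sublinear q -> (forall x, q x <= p x) -> q = p.
Proof.
move=> sp0.
pose T := {p : V -> R | sublinear p /\ forall x, p x <= p0 x}.
pose le_T (p q : T) := `[< forall x, sval q x <= sval p x >].
have t0 : T by exists p0; split.
have [||A Atot|[p [sp pp0]] pmax] := @ZL_preorder T t0 le_T.
- by move=> p; apply/asboolP.
- by move=> p q r /asboolP pq /asboolP qr; apply/asboolP => x; apply: le_trans (pq x).
- have [[a Aa]|A0] := pselect (A !=set0); last first.
    by exists t0 => s As; exfalso; apply: A0; exists s.
  have [|||q sq qA] := @sublinear_chain_inf [set sval p | p in A].
  + by exists (sval a), a.
  + by move=> _ [[p []] ? ? _ <-].
  + move=> _ _ [p Ap <-] [q Aq <-].
    by have [/asboolP|/asboolP] := Atot _ _ Ap Aq; [right|left].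
  have qp0 x : q x <= p0 x.
    by rewrite (le_trans (qA (sval a) _ x))//; [exists a|case: (svalP a)].
  exists (exist _ q (conj sq qp0)) => s As; apply/asboolP => x /=.
  by apply: qA; exists s.
exists p => //; split=> // q sq qp; apply/funext => x; apply/eqP.
rewrite eq_le qp/=.
have qp0 y : q y <= p0 y := le_trans (qp y) (pp0 y).
have /asboolP/(_ x) := pmax (exist _ q (conj sq qp0)) (asboolT qp).
exact.
Qed.

(** The Hahn-Banach theorem in the form of sublinear functions. A minimal sublinear
    function q equals each of its own shifts, that is q x <= q (x + z) - q z;
    so q is additive, hence linear. *)
Theorem sublinear_dominated_functional p y : sublinear p ->
  exists2 f : {scalar V}, forall x, f x <= p x & f y = p y.
Proof.
move=> sp; have [p1 sp1 p1le] := sublinear_shift y sp.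
have [q sq [qp1 qmin]] := minimal_sublinear sp1.
have qD x z : q (x + z) = q x + q z.
  have [r sr rle] := sublinear_shift z sq.
  have rq : r = q.
    apply: qmin => // w; have := rle 0 w (lexx 0).
    by rewrite scale0r addr0 mul0r subr0.
  apply/eqP; rewrite eq_le sq.1/=.
  by have := rle 1 x ler01; rewrite rq scale1r mul1r; lra.
have qN x : q (- x) = - q x.
  by have := qD x (- x); rewrite subrr sublinear0//; lra.
have qZ t x : q (t *: x) = t * q x.
  have [t0|t0] := leP 0 t; first exact: sublinearZ.
  rewrite -[t in LHS]opprK scaleNr qN sublinearZ// ?oppr_ge0 1?ltW//.
  by rewrite mulNr opprK.
have qlin : scalar q by move=> t x z /=; rewrite qD qZ.
pose f : {scalar V} := HB.pack q (GRing.isLinear.Build _ _ _ _ q qlin).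
have fp x : f x <= p x.
  have := p1le 0 x (lexx 0); rewrite scale0r addr0 mul0r subr0.
  exact: le_trans.
exists f => //; apply/eqP; rewrite eq_le fp/=.
have : q (- y) <= - p y.
  have := le_trans (qp1 _) (p1le 1 (- y) ler01).
  by rewrite scale1r addNr sublinear0// mul1r sub0r.
by rewrite qN /f/=; lra.
Qed.

End hahn_banach.

Section bounded_functionals.
Context {R : realType} {Z : normedModType R}.

Lemma dual_of_bounded (g : Z -> R) (C : R) : scalar g ->
  (forall z, `|g z| <= C * `|z|) -> exists f : continuous_dual Z, f =1 g.
Proof.
move=> glin gC.
pose f : {scalar Z} := HB.pack g (GRing.isLinear.Build _ _ _ _ g glin).
have fc : continuous f.
  apply/(@linear_bounded_continuous R Z R^o f)/linear_boundedP.
  apply: filterS (nbhs_pinfty_ge (num_real C)) => r /= Cr x.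
  by rewrite (le_trans (gC x))// ler_wpM2r.
by exists (ContinuousDual fc).
Qed.

Lemma dual_continuous (f : continuous_dual Z) : continuous f.
Proof. by case: f. Qed.

Lemma dual_bounded (f : continuous_dual Z) :
  exists2 C : R, 0 < C & forall z, `|f z| <= C * `|z|.
Proof.
have /(@linear_bounded_continuous R Z R^o f)/linear_boundedP := @dual_continuous f.
by move=> /pinfty_ex_gt0[C C0 fC]; exists C.
Qed.

Theorem norming_functional (z : Z) : exists2 f : continuous_dual Z,
  f z = `|z| & forall w, `|f w| <= `|w|.
Proof.
have sn : sublinear (fun w : Z => `|w|).
  split=> [x y|t x t0]; first exact: ler_normD.
  by rewrite normrZ gtr0_norm.
have [f0 f0le f0z] := sublinear_dominated_functional z sn.
have f0b w : `|f0 w| <= 1 * `|w|.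
  rewrite mul1r ler_norml f0le andbT lerNl -linearN (le_trans (f0le _))//.
  by rewrite normrN.
have [f ff] := dual_of_bounded (linearP f0) f0b.
by exists f => [|w]; rewrite ff// -[leRHS]mul1r.
Qed.

End bounded_functionals.

(** * Weakly compact sets *)

(** Dependent choice with access to the whole history; in gliding hump arguments
    the next choice depends on all the previous ones. *)
Lemma history_choice (T : Type) (P : seq T -> T -> Prop) :
  (forall h, exists t, P h t) ->
  exists u : nat -> T, forall j, P (mkseq u j) (u j).
Proof.
move=> /choice[step stepP].
pose hist j := iter j (fun h => rcons h (step h)) [::].
exists (step \o hist) => j.
have -> : mkseq (step \o hist) j = hist j; last exact: stepP.
by elim: j => // j IH; rewrite mkseqS IH.
Qed.

Section weak_compactness.
Context {R : realType} {Z : normedModType R}.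
Implicit Types (K : set Z) (f g : continuous_dual Z).

Lemma weak_nbhs f (u : Z) (d : R) : 0 < d ->
  nbhs (u : weak_topology Z) [set z : Z | `|f z - f u| < d].
Proof.
move=> d0; have [+ _] := @weak_cvgP R Z (nbhs (u : weak_topology Z)) u _.
by move=> /(_ (@cvg_id _ _) f) /cvgrPdistC_lt; exact.
Qed.

Lemma weak_nbhs_all (fs : seq (continuous_dual Z)) (u : Z) (d : R) : 0 < d ->
  nbhs (u : weak_topology Z)
    [set z : Z | all (fun f : continuous_dual Z => `|f z - f u| < d) fs].
Proof.
move=> d0; elim: fs => [|f fs IH] /=; first exact: filterS filterT.
by apply: filterS2 (weak_nbhs f u d0) IH => z /= -> ->.
Qed.

(** The gliding humps below only need that the sequence returns infinitely often to
    every weak neighbourhood of a cluster point, that is, close to u for finitely many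
    functionals at a time. *)
Lemma weakly_compact_cluster K (s : nat -> Z) :
  weakly_compact K -> (forall n, K (s n)) -> exists2 u, K u &
  forall fs (d : R) N, 0 < d -> exists2 n, (N <= n)%N &
    all (fun f : continuous_dual Z => `|f (s n) - f u| < d) fs.
Proof.
move=> cK sK; have FK : (s @ \oo) K by exists 0%N => // n _; exact: sK.
have [u [Ku su]] := cK (s @ \oo) _ FK.
exists u => // fs d N d0.
have [|_ [[n /= Nn <-] Hn]] := su (s @` [set n | (N <= n)%N]) _ _ (weak_nbhs_all fs u d0).
  by exists N => // n /= Nn; exists n.
by exists n.
Qed.

Lemma dual_series (g : nat -> continuous_dual Z) (C : R) :
  (forall k z, \sum_(0 <= i < k) `|g i z| <= C * `|z|) ->
  exists f : continuous_dual Z,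
    forall z, \sum_(0 <= i < k) g i z @[k --> \oo] --> f z.
Proof.
move=> gC.
have gcvg z : cvgn (fun k => \sum_(0 <= i < k) g i z).
  apply: (@normed_cvg _ _ (fun i => g i z)); apply: nondecreasing_is_cvgn.
    apply: nondecreasing_series => n _ _ /=; exact: normr_ge0.
  by exists (C * `|z|) => _ [k _ <-]; exact: gC.
pose f z : R := limn (fun k => \sum_(0 <= i < k) g i z).
have fP z : \sum_(0 <= i < k) g i z @[k --> \oo] --> f z by exact: gcvg.
have flin : scalar f.
  move=> a x y; apply: cvg_lim => //.
  under eq_fun do under eq_bigr do rewrite linearP.
  under eq_fun do rewrite big_split/= -mulr_sumr.
  by apply: cvgD => //; apply: cvgM => //; exact: cvg_cst.
have fC z : `|f z| <= C * `|z|.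
  have fn : `|\sum_(0 <= i < k) g i z| @[k --> \oo] --> `|f z|.
    exact: cvg_norm (fP z).
  rewrite -(cvg_lim _ fn)//.
  apply: limr_le; first by apply/cvg_ex; exists `|f z|.
  by apply: nearW => k; rewrite (le_trans (ler_norm_sum _ _ _)).
by have [F FE] := dual_of_bounded flin fC; exists F => z; rewrite FE.
Qed.

Lemma weakly_compact_dual_bounded K f : weakly_compact K ->
  exists M, forall z, K z -> `|f z| <= M.
Proof.
move=> cK; apply: contrapT => nM.
have /choice[s sP] n : exists z, K z /\ n%:R < `|f z|.
  apply: contrapT => nz; apply: nM; exists n%:R => z Kz.
  by rewrite leNgt; apply/negP => fz; apply: nz; exists z.
have [u Ku ucl] := weakly_compact_cluster cK (fun n => (sP n).1).
have [n Nn /=] := ucl [:: f] 1 (Num.truncn (`|f u| + 1)).+1 ltr01.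
rewrite andbT => fsu; have [_ fn] := sP n.
have : `|f u| + 1 < n%:R.
  by rewrite (lt_le_trans (truncnS_gt _))// ler_nat.
have := ler_normD (f (s n) - f u) (f u); rewrite subrK; lra.
Qed.

Lemma sign_normD (a b : R) : exists2 t : R, `|t| <= 1 & `|b| <= `|a + t * b|.
Proof.
have [ab|ab] := leP (0 : R) (a * b).
  exists 1; first by rewrite normr1.
  rewrite mul1r -ler_sqr ?nnegrE// !real_normK ?num_real//.
  by have := sqr_ge0 a; rewrite !expr2; lra.
exists (-1); first by rewrite normrN1.
rewrite mulN1r -ler_sqr ?nnegrE// !real_normK ?num_real//.
by have := sqr_ge0 a; rewrite !expr2; lra.
Qed.

(** The uniform boundedness principle for the dual, proved by a direct construction.
    If z_k in K has norm larger than 2 k 3^k and phi_k norms z_k, the signs t_k can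
    be chosen one after the other so that f = sum t_k 3^-k phi_k satisfies
    |f z_k| >= 3^-k |z_k| / 2: at each step the sign makes the k-th term add up with
    the preceding ones, and the terms after it sum to at most half of it. Then f
    would be unbounded on K. *)
Theorem weakly_compact_bounded K : weakly_compact K ->
  exists M, forall z, K z -> `|z| <= M.
Proof.
move=> cK; apply: contrapT => nM.
pose a : R := 3^-1.
have a0 k : 0 < a ^+ k by rewrite exprn_gt0// invr_gt0.
have aS k : a ^+ k = 3 * a ^+ k.+1 by rewrite exprS mulrA mulfV// mul1r.
have /choice[z zP] k : exists z, K z /\ 2 * k%:R < a ^+ k * `|z|.
  apply: contrapT => nz; apply: nM; exists ((a ^+ k)^-1 * (2 * k%:R)) => z Kz.
  rewrite ler_pdivlMl// leNgt; apply/negP => fz; apply: nz.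
  by exists z.
have /choice[phi phiP] k : exists f : continuous_dual Z,
    f (z k) = `|z k| /\ forall w, `|f w| <= `|w|.
  by have [f] := norming_functional (z k); exists f.
have [|t tP] := @history_choice R (fun h t => `|t| <= 1 /\
   a ^+ (size h) * `|z (size h)| <=
   `|\sum_(0 <= i < size h) (h`_i * a ^+ i) * phi i (z (size h)) +
     t * (a ^+ size h * phi (size h) (z (size h)))|).
  move=> h; have [t t1 tle] := sign_normD
    (\sum_(0 <= i < size h) (h`_i * a ^+ i) * phi i (z (size h)))
    (a ^+ size h * phi (size h) (z (size h))).
  exists t; split => //; apply: le_trans tle.
  by rewrite (phiP _).1 normrM normr_id gtr0_norm.
have t1 i : `|t i| <= 1 by have [] := tP i.
have phile i w : `|(t i * a ^+ i) * phi i w| <= a ^+ i * `|w|.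
  rewrite !normrM (gtr0_norm (a0 i)) -mulrA -[leRHS]mul1r.
  apply: ler_pM => //; first by rewrite mulr_ge0// ltW.
  by rewrite ler_wpM2l ?(ltW (a0 i))//; apply: (phiP i).2.
have /choice[g gP] i : exists f : continuous_dual Z,
    f =1 (fun w => (t i * a ^+ i) * phi i w).
  apply: (@dual_of_bounded _ _ _ (a ^+ i)) => // b x y.
  by rewrite linearP mulrDr /= mulrCA.
have [|f fP] := @dual_series g (3 / 2).
  move=> k w; have : \sum_(0 <= i < k) `|g i w| <= (3 / 2 - 3 / 2 * a ^+ k) * `|w|.
    elim: k => [|k IH]; first by rewrite big_geq// expr0 mulr1 subrr mul0r.
    have := phile k w; rewrite -gP big_nat_recr//=.
    have -> : (3 / 2 - 3 / 2 * a ^+ k.+1) * `|w| =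
      (3 / 2 - 3 / 2 * a ^+ k) * `|w| + a ^+ k * `|w| by rewrite (aS k); field.
    lra.
  by move=> /le_trans; apply; rewrite ler_wpM2r// gerBl mulr_ge0 ?ltW.
have flow k : k%:R <= `|f (z k)|.
  have low n : (a ^+ k + a ^+ (k + n)) / 2 * `|z k| <=
      `|\sum_(0 <= i < (k + n).+1) g i (z k)|.
    elim: n => [|n IH].
      rewrite addn0 mulrDl -splitr big_nat_recr//= gP.
      have [_] := tP k; rewrite size_mkseq => /le_trans; apply.
      rewrite -mulrA le_eqVlt; apply/orP; left; apply/eqP; congr `|_ + _|.
      by apply: eq_big_nat => i /andP[_ ik]; rewrite nth_mkseq// gP.
    rewrite addnS big_nat_recr//=.
    set S := \sum_(0 <= i < _) _ in IH *.
    have := ler_normD (S + g (k + n).+1 (z k)) (- g (k + n).+1 (z k)).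
    rewrite addrK normrN => H.
    have := phile (k + n).+1 (z k); rewrite -gP => H2.
    have -> : (a ^+ k + a ^+ (k + n).+1) / 2 * `|z k| =
      (a ^+ k + a ^+ (k + n)) / 2 * `|z k| - a ^+ (k + n).+1 * `|z k|.
      by rewrite (aS (k + n)%N); field.
    lra.
  have fn : `|\sum_(0 <= i < n) g i (z k)| @[n --> \oo] --> `|f (z k)|.
    exact: cvg_norm (fP (z k)).
  rewrite -(cvg_lim _ fn)//.
  apply: limr_ge; first by apply/cvg_ex; exists `|f (z k)|.
  exists k.+1 => // n /= kn; rewrite -(subnKC kn) addSn.
  apply: le_trans (low _); have [_ zk] := zP k.
  have : 0 <= a ^+ (k + (n - k.+1)) * `|z k| by rewrite mulr_ge0// ltW.
  by rewrite mulrAC mulrDl; lra.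
have [M MP] := weakly_compact_dual_bounded f cK.
have := MP _ (zP (Num.truncn M).+1).1.
have := truncnS_gt M; have := flow (Num.truncn M).+1; lra.
Qed.

Lemma dual_comp_bounded g (L : {linear Z -> Z}) (C : R) :
  (forall z, `|L z| <= C * `|z|) ->
  exists h : continuous_dual Z, forall z, h z = g (L z).
Proof.
move=> LC; have [D D0 gD] := dual_bounded g.
apply: (@dual_of_bounded _ _ _ (D * C)) => [b x y|z].
  by rewrite linearP /= linearP.
by rewrite -mulrA (le_trans (gD _))// ler_wpM2l// ltW.
Qed.

End weak_compactness.

(** * Uniformly small tails on weakly compact sets *)

(** An abstract form of the proof of the Schur property of l_1. The operators T n are
    tails and E n m is the part of T n before m. The hypothesis E_sum says that
    disjoint blocks add up in the l_1 sense. *)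
Section gliding_hump.
Context {R : realType} {Z : normedModType R}.
Variables (T : nat -> {linear Z -> Z}) (E : nat -> nat -> {linear Z -> Z}).
Hypothesis T_cvg0 : forall z, T n z @[n --> \oo] --> (0 : Z).
Hypothesis E_cvg : forall n z, E n m z @[m --> \oo] --> T n z.
Hypothesis E_T : forall m n k z, (m <= n)%N -> (n <= k)%N ->
  E n k (T m z) = E n k z.
Hypothesis E_sum : forall n m : nat -> nat,
  (forall i, (n i <= m i <= n i.+1)%N) ->
  forall k z, \sum_(0 <= i < k) `|E (n i) (m i) z| <= 2 * `|z|.

Lemma hump_bound n m z : (n <= m)%N -> `|E n m z| <= 2 * `|z|.
Proof.
move=> nm; have := E_sum (n := fun i => if i == 0%N then n else m) (m := fun=> m) _ 1 z.
rewrite big_nat1; apply => i; rewrite leqnn andbT; by case: ifP.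
Qed.

(** Otherwise some s_n in K has T n s_n large for every n. Let u be a weak cluster
    point and v_n = s_n - u, whose tails are large as well. Inductively one finds
    disjoint blocks E n_j m_j that carry most of T n_j v_(n_j), with norming
    functionals g_j that are tiny at all later v_(n_i); as the blocks add up in the
    l_1 sense, f = sum g_j is a bounded functional, and f v_(n_j) stays away from 0.
    But a weak cluster point w of the s_(n_j) agrees with u under each g_j, hence
    under f, a contradiction. *)
Theorem weakly_compact_small_tails (K : set Z) (e : R) : weakly_compact K ->
  0 < e -> exists N, forall z, K z -> `|T N z| <= e.
Proof.
move=> cK e0; apply: contrapT => nK.
have /choice[s sP] n : exists z, K z /\ e < `|T n z|.
  apply: contrapT => nz; apply: nK; exists n => z Kz.
  by rewrite leNgt; apply/negP => fz; apply: nz; exists z.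
have sK n : K (s n) by have [] := sP n.
have [u Ku ucl] := weakly_compact_cluster cK sK.
have [N0 _ N0P] : \forall n \near \oo, `|T n u| < e / 4.
  by have /cvgr0Pnorm_lt := T_cvg0 u; apply; rewrite divr_gt0.
pose v n := s n - u.
have Tv n : (N0 <= n)%N -> 3 * e / 4 < `|T n (v n)|.
  move=> nN; rewrite /v linearB/=; have := N0P n nN; have := (sP n).2.
  have := ler_normD (T n (s n) - T n u) (T n u); rewrite subrK /=; lra.
(* A state (n, m, g): a hump of v n sits between n and m, and g sees only this
   block. *)
pose state := (nat * nat * continuous_dual Z)%type.
pose good (h : seq state) (t : state) :=
  [/\ all (fun t' => t'.1.2 <= t.1.1)%N h /\ (t.1.1 <= t.1.2)%N,
      all (fun t' : state => `|t'.2 (v t.1.1)| <= e / 8 / (size h).+1%:R) h,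
      e / 2 < t.2 (v t.1.1) /\ (forall z, `|t.2 z| <= `|E t.1.1 t.1.2 z|) &
      `|T t.1.2 (v t.1.1)| <= e / 16].
have goodP h : exists t, good h t.
  have d0 : 0 < e / 8 / (size h).+1%:R by rewrite !divr_gt0.
  have [N1 N1P] : exists N1, all (fun t' : state => t'.1.2 <= N1)%N h.
    elim: h {d0} => [|t h [N1 N1P]]; first by exists 0%N.
    exists (maxn t.1.2 N1); rewrite /= leq_maxl; apply: sub_all N1P => t' /=.
    by move=> /leq_trans; apply; exact: leq_maxr.
  have [n Nn ncl] := ucl [seq t.2 | t <- h] _ (maxn N0 N1) d0.
  move: Nn; rewrite geq_max => /andP[N0n N1n].
  have [m1 _ m1P] : \forall m \near \oo, e / 2 < `|E n m (v n)|.
    have En : `|E n m (v n)| @[m --> \oo] --> `|T n (v n)|.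
      exact: cvg_norm (@E_cvg n (v n)).
    have := cvgr_gt _ En; apply.
    by rewrite (lt_trans _ (Tv n N0n))//; lra.
  have [m2 _ m2P] : \forall m \near \oo, `|T m (v n)| < e / 16.
    by have /cvgr0Pnorm_lt := T_cvg0 (v n); apply; rewrite divr_gt0.
  pose m := maxn n (maxn m1 m2).
  have [phi phiv phile] := norming_functional (E n m (v n)).
  have [g gE] := dual_comp_bounded phi (fun z => hump_bound z (leq_maxl n (maxn m1 m2))).
  exists (n, m, g); split => /=.
  - split; last exact: leq_maxl.
    by apply: sub_all N1P => t' /= /leq_trans; apply.
  - move: ncl; rewrite all_map; apply: sub_all => t' /= /ltW.
    by rewrite /v linearB.
  - split; last by move=> z; rewrite gE.
    by rewrite gE phiv m1P//= /m leq_max leq_maxl orbT.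
  - by rewrite ltW// m2P//= /m leq_max leq_maxr orbT.
have [st stP] := history_choice goodP.
pose n i := (st i).1.1; pose m i := (st i).1.2; pose g i := (st i).2.
have nm i : (n i <= m i)%N by have [[]] := stP i.
have mn i j : (i < j)%N -> (m i <= n j)%N.
  move=> ij; have [[/(all_nthP (st 0%N))/(_ i)]] := stP j.
  by rewrite size_mkseq nth_mkseq// => /(_ ij).
have gsmall i j : (i < j)%N -> `|g i (v (n j))| <= e / 8 / j.+1%:R.
  move=> ij; have [_ /(all_nthP (st 0%N))/(_ i)] := stP j.
  by rewrite size_mkseq nth_mkseq// => /(_ ij).
have gbig j : e / 2 < g j (v (n j)) by have [_ _ []] := stP j.
have gE j z : `|g j z| <= `|E (n j) (m j) z| by have [_ _ []] := stP j.
have Tsmall j : `|T (m j) (v (n j))| <= e / 16 by have [] := stP j.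
have [|f fP] := @dual_series _ _ g 2.
  move=> k z; apply: le_trans (E_sum (n := n) (m := m) _ k z).
    by apply: ler_sum => i _; exact: gE.
  by move=> i; rewrite nm mn.
(* The terms before j are small by the choice of n j, those after j because they
   only see the tail of v (n j) beyond m j. *)
have fbig j : e / 4 <= f (v (n j)).
  rewrite -(cvg_lim _ (fP (v (n j))))//.
  apply: limr_ge; first by apply/cvg_ex; exists (f (v (n j))).
  exists j.+1 => // k /= jk.
  rewrite (big_cat_nat (n := j))//= ?(ltnW jk)// (big_ltn jk).
  have head : `|\sum_(0 <= i < j) g i (v (n j))| <= e / 8.
    rewrite (le_trans (ler_norm_sum _ _ _))//.
    have : \sum_(0 <= i < j) `|g i (v (n j))| <=
        \sum_(0 <= i < j) e / 8 / j.+1%:R.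
      by apply: ler_sum_nat => i /andP[_ ij]; exact: gsmall.
    move=> /le_trans; apply; rewrite sumr_const_nat subn0.
    rewrite -[leLHS]mulr_natr -[leLHS]mulrA.
    by rewrite ler_piMr ?divr_ge0 ?ltW// mulrC ltr_pdivrMr// mul1r ltr_nat.
  have tail : `|\sum_(j.+1 <= i < k) g i (v (n j))| <= e / 8.
    rewrite (le_trans (ler_norm_sum _ _ _))//.
    have ET := E_sum (n := fun i => n (i + j.+1)%N)
      (m := fun i => m (i + j.+1)%N) _ (k - j.+1) (T (m j) (v (n j))).
    apply: le_trans (le_trans (ET _) _).
    - rewrite -{1}[j.+1]add0n big_addn; apply: ler_sum => i _.
      by rewrite (le_trans (gE _ _))// E_T// mn// addnS ltnS leq_addl.
    - by move=> i; rewrite nm mn// addSn.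
    - have := Tsmall j; lra.
  have := gbig j.
  move: head tail; rewrite !ler_norml => /andP[] h1 _ /andP[] h2 _ h3.
  lra.
have [w Kw wcl] := weakly_compact_cluster cK (fun j => sK (n j)).
(* Both s_(n_j) - u and, for frequent j, s_(n_j) - w are small under g i. *)
have gw i : g i w = g i u.
  apply/eqP; rewrite -subr_eq0 -normr_le0; apply/ler_addgt0Pl => d d0.
  have d20 : 0 < d / 2 by rewrite divr_gt0.
  pose N := maxn i.+1 (Num.truncn (e / 8 / (d / 2))).
  have [j Nj /=] := wcl [:: g i] _ N d20; rewrite andbT => jw.
  move: Nj; rewrite geq_max => /andP[ij Nj].
  have jd : e / 8 / j.+1%:R <= d / 2.
    rewrite ler_pdivrMr// [leRHS]mulrC -ler_pdivrMr//.
    by rewrite ltW// (lt_le_trans (truncnS_gt _))// ler_nat ltnS.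
  have := le_trans (gsmall _ _ ij) jd; rewrite /v linearB /= => ju.
  have := ler_distD (g i (s (n j))) (g i w) (g i u).
  by rewrite addr0 (distrC (g i w) (g i (s _))); lra.
have fw : f w = f u.
  have fu := fP u; have := fP w.
  under eq_fun do under eq_bigr do rewrite gw.
  by move=> fw; rewrite -(cvg_lim _ fw)// -(cvg_lim _ fu).
have e80 : 0 < e / 8 by rewrite divr_gt0.
have [j _ /=] := wcl [:: f] _ 0%N e80; rewrite andbT fw => fj.
have := fbig j; rewrite /v linearB /= => fj'.
have := ler_norm (f (s (n j)) - f u); lra.
Qed.

End gliding_hump.

(** * Strong weak compact generation from projections *)

Section swcg_criterion.
Context {R : realType} {Z : completeNormedModType R}.

(** An ultrafilter on the union either contains some S m, or it leaves every S m and
    then converges to 0 in norm, since the sets S m shrink. *)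
Lemma weakly_compact_bigcup (S : nat -> set Z) (c : nat -> R) :
  (forall m, weakly_compact (S m)) -> (forall m, S m 0) ->
  (forall m z, S m z -> `|z| <= c m) -> c @ \oo --> (0 : R) ->
  weakly_compact (\bigcup_m S m).
Proof.
move=> cS S0 Sc c0; rewrite /weakly_compact compact_ultra => F FU FS.
have [[m FSm]|nF] := pselect (exists m, F (S m)).
  have := cS m; rewrite /weakly_compact compact_ultra.
  by move=> /(_ F FU FSm)[p [Smp Fp]]; exists p; split => //; exists m.
have FC N : F [set z | forall m, (m < N)%N -> ~ S m z].
  elim: N => [|N IH]; first exact: filterS filterT.
  have [FSN|] := in_ultra_setVsetC (S N) FU; first by exfalso; apply: nF; exists N.
  apply: filterS2 IH => z zm zN m; rewrite ltnS leq_eqVlt => /predU1P[->//|].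
  exact: zm.
exists 0; split; first by exists 0%N.
apply/(@weak_cvgP R Z F (0 : Z)) => f; rewrite linear0.
apply/cvgr0Pnorm_lt => e e0; have [D D0 fD] := dual_bounded f.
have [N _ NP] : \forall m \near \oo, `|c m| < e / D.
  by have /cvgr0Pnorm_lt := c0; apply; rewrite divr_gt0.
apply: filterS2 FS (FC N) => z [m _ Smz] zN.
rewrite (le_lt_trans (fD z))// mulrC -ltr_pdivlMr//.
rewrite (le_lt_trans (Sc _ _ Smz))// (le_lt_trans (ler_norm _))// NP//=.
by rewrite leqNgt; apply/negP => mN; exact: zN mN Smz.
Qed.

(** The generating set is the union over m of the balls of radius 1/(m+1) in the
    ranges of the projections A m: a ball of any radius in any one of these ranges
    lies in a multiple of it. *)
Theorem SWCG_of_projections (A : nat -> {linear Z -> Z}) (C : R) :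
  0 <= C -> (forall m z, `|A m z| <= C * `|z|) -> (forall m z, A m (A m z) = A m z) ->
  (forall m r, 0 < r -> weakly_compact [set z : Z | `|z| <= r /\ A m z = z]) ->
  (forall (K : set Z) e, weakly_compact K -> 0 < e ->
     exists m, forall z, K z -> `|z - A m z| <= e) ->
  SWCG Z.
Proof.
move=> C0 AC AA cA AK.
pose S m := [set z : Z | `|z| <= m.+1%:R^-1 /\ A m z = z].
exists (\bigcup_m S m).
  apply: (@weakly_compact_bigcup _ (fun m => m.+1%:R^-1)).
  - by move=> m; apply: cA; rewrite invr_gt0.
  - by move=> m; split; rewrite ?normr0 ?invr_ge0// linear0.
  - by move=> m z [].
  - exact: cvg_harmonic.
move=> K cK e e0; have [m mP] := AK K e cK e0.
have [M MP] := weakly_compact_bounded cK.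
pose n := (Num.truncn (C * M * m.+1%:R)).+1.
have n0 : 0 < n%:R :> R by [].
exists n => z Kz; exists (n%:R^-1 *: A m z).
  exists m => //; split; last by rewrite linearZ/= AA.
  rewrite normrZ gtr0_norm ?invr_gt0// ler_pdivrMl// ler_pdivlMr//.
  apply: le_trans (ltW (truncnS_gt _)); rewrite ler_wpM2r//.
  by rewrite (le_trans (AC m z))// ler_wpM2l// MP.
exists (e^-1 *: (z - A m z)).
  by rewrite /= normrZ gtr0_norm ?invr_gt0// ler_pdivrMl// mulr1 mP.
by rewrite !scalerA !mulfV ?gt_eqF// !scale1r addrC subrK.
Qed.

End swcg_criterion.

(** * Bounded operators on a projective tensor product *)

Section completion_extension.
Context {R : realType} {V : lmodType R} (q : seminorm V).
Context {W : completeNormedModType R}.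

(** The value F z is characterized by |F z - L v| <= C |z - v| for all v; every
    property of F is read off from this estimate and the density of V. *)
Theorem completion_extension (L : {linear V -> W}) (C : R) : 0 <= C ->
  (forall v, `|L v| <= C * q v) -> exists F : {linear completion q -> W},
    (forall v, F (to_completion q v) = L v) /\ forall z, `|F z| <= C * `|z|.
Proof.
move=> C0 LC; pose iota := to_completion q.
have Ldist u v : `|L u - L v| <= C * `|iota u - iota v|.
  by rewrite -!linearB norm_to_completion.
have /choice[F FP] (z : completion q) :
    exists w, forall v, `|w - L v| <= C * `|z - iota v|.
  have inv_gt0 n : 0 < (n.+1%:R : R)^-1 by rewrite invr_gt0.
  have /choice[v vz] n : exists v, `|z - iota v| < n.+1%:R^-1.
    exact: to_completion_dense.
  have inv_lt (e : R) : 0 < e -> \forall n \near \oo, C * n.+1%:R^-1 < e.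
    move=> e0; have : C * n.+1%:R^-1 @[n --> \oo] --> C * 0.
      by apply: cvgM; [exact: cvg_cst|exact: cvg_harmonic].
    by rewrite mulr0 => /cvgr_lt; apply.
  have Lbound n u : `|L (v n) - L u| <= C * n.+1%:R^-1 + C * `|z - iota u|.
    rewrite (le_trans (Ldist _ _))// -mulrDr ler_wpM2l//.
    rewrite (le_trans (ler_distD z _ _))// lerD2r distrC ltW//.
  have /cvg_ex[w Lw] : cvg (L (v n) @[n --> \oo]).
    apply/cauchy_cvgP/cauchyP => e e0.
    have [N _ NP] := inv_lt (e / 2) (divr_gt0 e0 (ltr0Sn R 1)).
    exists (L (v N)), N => // n /= Nn.
    rewrite -ball_normE /= distrC (le_lt_trans (Lbound _ _))//.
    rewrite [ltRHS]splitr ltr_leD ?NP//.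
    by rewrite (le_trans (ler_wpM2l C0 (ltW (vz N))))// ltW// NP /=.
  exists w => u; apply/ler_addgt0Pl => e e0.
  have e20 : 0 < e / 2 by rewrite divr_gt0.
  have /cvgrPdist_lt/(_ _ e20)[N _ NP] := Lw.
  have [M _ MP] := inv_lt _ e20.
  have /= H1 := NP (maxn N M) (leq_maxl _ _).
  have /= H2 := MP (maxn N M) (leq_maxr _ _).
  rewrite (le_trans (ler_distD (L (v (maxn N M))) w (L u)))//.
  rewrite (splitr e) -addrA lerD ?(ltW H1)//.
  by rewrite (le_trans (Lbound _ u))// lerD2r ltW.
have FL v : F (iota v) = L v.
  apply/eqP; rewrite -subr_eq0 -normr_le0 (le_trans (FP _ v))//.
  by rewrite subrr normr0 mulr0.
have FC z : `|F z| <= C * `|z|.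
  have i0 : iota 0 = 0 := linear0 _; have L0 : L 0 = 0 := linear0 _.
  by have := FP z 0; rewrite i0 L0 !subr0.
have Flin : linear F.
  move=> a y z; apply/eqP; rewrite -subr_eq0 -normr_le0.
  apply/ler_addgt0Pl => e e0; rewrite addr0.
  pose d := e / (2 * (C * (`|a| + 1)) + 1).
  have D0 : 0 < 2 * (C * (`|a| + 1)) + 1.
    by rewrite ltr_wpDl// !mulr_ge0// addr_ge0.
  have d0 : 0 < d by rewrite divr_gt0.
  have [u uy] := to_completion_dense y d0; have [v vz] := to_completion_dense z d0.
  have -> : F (a *: y + z) - (a *: F y + F z) =
      (F (a *: y + z) - L (a *: u + v)) - (a *: (F y - L u) + (F z - L v)).
    have LE : L (a *: u + v) = a *: L u + L v by rewrite linearP.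
    have key (p l1 l2 f1 f2 : W) :
        p - (f1 + f2) = p - (l1 + l2) - ((f1 - l1) + (f2 - l2)).
      by rewrite [f1 - l1 + _]addrACA -opprD opprB [RHS]addrA subrK.
    by rewrite LE scalerBr; exact: key.
  rewrite (le_trans (ler_normB _ _))//.
  have H1 : `|F (a *: y + z) - L (a *: u + v)| <= C * (`|a| * d + d).
    rewrite (le_trans (FP _ _))// ler_wpM2l// /iota linearP opprD addrACA -scalerBr.
    rewrite (le_trans (ler_normD _ _))// normrZ lerD// ?ler_wpM2l// ltW//.
  have H2 : `|a *: (F y - L u) + (F z - L v)| <= `|a| * (C * d) + C * d.
    rewrite (le_trans (ler_normD _ _))// normrZ lerD// ?ler_wpM2l//.
      by rewrite (le_trans (FP _ _))// ler_wpM2l// ltW.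
    by rewrite (le_trans (FP _ _))// ler_wpM2l// ltW.
  rewrite (le_trans (lerD H1 H2))//.
  have -> : C * (`|a| * d + d) + (`|a| * (C * d) + C * d) =
     2 * (C * (`|a| + 1)) * d by ring.
  by rewrite /d mulrC mulrAC ler_pdivrMr// ler_wpM2l ?ltW// ltrDl.
pose F' : {linear completion q -> W} :=
  HB.pack F (GRing.isLinear.Build _ _ _ _ F Flin).
by exists F'.
Qed.

End completion_extension.

Section projective_tensor_theory.
Context {R : realType} {X Y : normedModType R}.
Local Notation Z := (projective_tensor X Y).

Definition ptens (x : X) (y : Y) : Z := to_completion _ (tens x y).

Lemma ptens_linearl a x x' y : ptens (a *: x + x') y = a *: ptens x y + ptens x' y.
Proof.
have /= := (tens_bilinear (X := X) (Y := Y)).1 y a x x'.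
by rewrite /ptens => ->; rewrite linearP.
Qed.

Lemma ptens_linearr a x y y' : ptens x (a *: y + y') = a *: ptens x y + ptens x y'.
Proof.
have /= := (tens_bilinear (X := X) (Y := Y)).2 x a y y'.
by rewrite /ptens => ->; rewrite linearP.
Qed.

Lemma ptensDl x x' y : ptens (x + x') y = ptens x y + ptens x' y.
Proof. by rewrite -[x in LHS]scale1r ptens_linearl scale1r. Qed.

Lemma ptensDr x y y' : ptens x (y + y') = ptens x y + ptens x y'.
Proof. by rewrite -[y in LHS]scale1r ptens_linearr scale1r. Qed.

Lemma ptens0l y : ptens 0 y = 0.
Proof. by apply: (addrI (ptens 0 y)); rewrite -ptensDl !addr0. Qed.

Lemma ptens0r x : ptens x 0 = 0.
Proof. by apply: (addrI (ptens x 0)); rewrite -ptensDr !addr0. Qed.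

Lemma ptensZl a x y : ptens (a *: x) y = a *: ptens x y.
Proof. by rewrite -[a *: x]addr0 ptens_linearl ptens0l addr0. Qed.

Lemma ptensZr a x y : ptens x (a *: y) = a *: ptens x y.
Proof. by rewrite -[a *: y]addr0 ptens_linearr ptens0r addr0. Qed.

Lemma ptensBl x x' y : ptens (x - x') y = ptens x y - ptens x' y.
Proof. by rewrite ptensDl -scaleN1r ptensZl scaleN1r. Qed.

Lemma ptensBr x y y' : ptens x (y - y') = ptens x y - ptens x y'.
Proof. by rewrite ptensDr -scaleN1r ptensZr scaleN1r. Qed.

Lemma norm_ptens x y : `|ptens x y| <= `|x| * `|y|.
Proof.
rewrite norm_to_completion /=.
have := @projective_norm_le_cost _ X Y (tens x y) [:: (x, y)].
by rewrite big_seq1 => /(_ erefl); rewrite /cost big_seq1.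
Qed.

Lemma ptens_dense (z : Z) (e : R) : 0 < e -> exists2 s : seq (X * Y),
  `|z - \sum_(xy <- s) ptens xy.1 xy.2| < e & cost s < `|z| + e.
Proof.
move=> e0; have e20 : 0 < e / 2 by rewrite divr_gt0.
have [t zt] := to_completion_dense z e20.
have [s ts sl] := projective_norm_approx t e20.
have E : to_completion (@projective_seminorm R X Y) t = \sum_(xy <- s) ptens xy.1 xy.2.
  by rewrite {1}ts linear_sum.
exists s; first by rewrite -E (lt_trans zt)// ltr_pdivrMr// ltr_pMr// ltr1n.
rewrite (lt_trans sl)//.
have <- : `|to_completion (@projective_seminorm R X Y) t| = projective_norm t.
  exact: norm_to_completion.
have := ler_distD z (to_completion (@projective_seminorm R X Y) t) 0.
by rewrite !subr0 distrC; lra.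
Qed.

(** This is the universal property of the projective norm, stated for subadditive
    bounded functions: z is approximated by a finite sum of elementary tensors whose
    cost is close to |z|. All the estimates below are checked on elementary tensors
    only and transferred by this theorem. *)
Theorem projective_le_on_tensors (N : Z -> R) (C c : R) :
  (forall z w, N (z + w) <= N z + N w) -> (forall z, N z <= C * `|z|) ->
  0 <= c -> (forall x y, N (ptens x y) <= c * (`|x| * `|y|)) ->
  forall z, N z <= c * `|z|.
Proof.
move=> ND NC c0 Nc z; apply/ler_addgt0Pr => e e0.
have D0 : 0 < `|C| + c + 1 by rewrite ltr_wpDl// addr_ge0.
have [s zs sl] := ptens_dense z (divr_gt0 e0 D0).
set w := \sum_(xy <- s) _ in zs.
have Nw : N w <= c * cost s.
  rewrite /w /cost; elim: s {zs sl w} => [|xy s IH].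
    by rewrite !big_nil mulr0 (le_trans (NC _))// normr0 mulr0.
  by rewrite !big_cons mulrDr (le_trans (ND _ _))// lerD// Nc.
have := ND (z - w) w; rewrite subrK => /le_trans; apply.
have H1 : N (z - w) <= `|C| * (e / (`|C| + c + 1)).
  rewrite (le_trans (NC _))// (le_trans (ler_wpM2r (normr_ge0 _) (ler_norm C)))//.
  by rewrite ler_wpM2l// ltW.
have H2 : c * cost s <= c * (`|z| + e / (`|C| + c + 1)) by rewrite ler_wpM2l// ltW.
have H3 : (`|C| + c) * (e / (`|C| + c + 1)) <= e.
  by rewrite mulrCA ler_piMr ?ltW// ltr_pdivrMr// mul1r ltrDl.
rewrite (le_trans (lerD H1 (le_trans Nw H2)))//.
by move: H3; rewrite mulrDl mulrDr; lra.
Qed.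

Lemma projective_eq_on_tensors (F G : {linear Z -> Z}) (C D : R) :
  (forall z, `|F z| <= C * `|z|) -> (forall z, `|G z| <= D * `|z|) ->
  (forall x y, F (ptens x y) = G (ptens x y)) -> forall z, F z = G z.
Proof.
move=> FC GD FG z; apply/eqP; rewrite -subr_eq0 -normr_le0 -(mul0r `|z|).
move: z; apply: (@projective_le_on_tensors (fun z => `|F z - G z|) (C + D) 0).
- move=> u v; rewrite /= (linearD F) (linearD G) opprD addrACA; exact: ler_normD.
- by move=> u; rewrite mulrDl; apply: le_trans (ler_normB _ _) (lerD (FC u) (GD u)).
- exact: lexx.
- by move=> x y; rewrite /= FG subrr normr0 mul0r.
Qed.

Lemma projective_functional (b : X -> Y -> R) (C : R) : 0 <= C ->
  (forall y, scalar (b ^~ y)) -> (forall x, scalar (b x)) ->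
  (forall x y, `|b x y| <= C * (`|x| * `|y|)) ->
  exists f : continuous_dual Z, forall x y, f (ptens x y) = b x y.
Proof.
move=> C0 bl br bC.
pose B : {bilinear X -> Y -> R | *%R & *%R} :=
  HB.pack b (bilinear_isBilinear.Build R X Y R *%R *%R b (bl, br)).
pose L (t : tensor X Y) : R^o := tensor_eval t B.
have Llin : linear L by move=> a t u.
have LC t : `|L t| <= C * @projective_seminorm R X Y t.
  apply/ler_addgt0Pr => e e0.
  have D0 : 0 < C + 1 by rewrite ltr_wpDl.
  have [s /tensor_eqP ts sl] := projective_norm_approx t (divr_gt0 e0 D0).
  rewrite /L ts /tensor_sum (le_trans (ler_norm_sum _ _ _))//.
  have : \sum_(xy <- s) `|B xy.1 xy.2| <= C * cost s.
    by rewrite /cost mulr_sumr; apply: ler_sum => xy _; exact: bC.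
  move=> /le_trans; apply; rewrite (le_trans (ler_wpM2l C0 (ltW sl)))//.
  by rewrite mulrDr lerD2l mulrCA ler_piMr ?ltW// ltr_pdivrMr// mul1r ltrDl.
pose L' : {linear tensor X Y -> R^o} :=
  HB.pack L (GRing.isLinear.Build _ _ _ _ L Llin).
have [F [FL FC]] := @completion_extension R _ _ R^o L' C C0 LC.
have [f fE] := @dual_of_bounded R Z F C (linearP F) FC.
exists f => x y; rewrite fE /ptens FL /= /L /= /tensor_sum big_seq1 //.
Qed.

(** Bundling the bound with the map makes U (x) V a total operation tmap, always of
    norm at most 1. All operators used below are contractions. *)
Record contraction (V : normedModType R) := Contraction {
  contraction_fun :> {linear V -> V};
  contractionP : forall v, `|contraction_fun v| <= `|v| }.

(** An algebraic tensor is a function of bilinear forms, so the map induced by U and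
    V is precomposition B |-> B (U _) (V _). *)
Lemma tensor_map_exists (U : {linear X -> X}) (V : {linear Y -> Y}) :
  exists L : {linear tensor X Y -> tensor X Y},
    forall x y, L (tens x y) = tens (U x) (V y).
Proof.
have bl (B : {bilinear X -> Y -> R | *%R & *%R}) y :
    scalar ((fun x y => B (U x) (V y)) ^~ y).
  by move=> a x x'; rewrite linearP linearDl linearZl_LR.
have br (B : {bilinear X -> Y -> R | *%R & *%R}) x :
    scalar ((fun x y => B (U x) (V y)) x).
  by move=> a y y'; rewrite linearP linearDr linearZr.
pose BUV (B : {bilinear X -> Y -> R | *%R & *%R})
   : {bilinear X -> Y -> R | *%R & *%R} :=
  HB.pack (fun x y => B (U x) (V y))
   (bilinear_isBilinear.Build R X Y R *%R *%R (fun x y => B (U x) (V y)) (bl B, br B)).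
have mem (t : tensor X Y) : (fun B => tensor_eval t (BUV B)) \in @tensor_pred R X Y.
  have [s ->] := tensorP t; apply/asboolP.
  exists [seq (U xy.1, V xy.2) | xy <- s]; apply/funext => B.
  by rewrite /tensor_sum big_map.
pose L (t : tensor X Y) := Tensor (mem t).
have Llin : linear L by move=> a t u; apply/val_inj/funext.
pose L' : {linear tensor X Y -> tensor X Y} :=
  HB.pack L (GRing.isLinear.Build _ _ _ _ L Llin).
exists L' => x y.
by apply/val_inj/funext => B /=; rewrite /tensor_sum !big_seq1.
Qed.

Lemma tmap_exists (U : contraction X) (V : contraction Y) :
  exists F : {linear Z -> Z}, (forall x y, F (ptens x y) = ptens (U x) (V y)) /\
    forall z, `|F z| <= `|z|.
Proof.
have [L LE] := tensor_map_exists U V.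
pose L' := fun t => to_completion (@projective_seminorm R X Y) (L t).
have L'lin : linear L' by move=> a t u; rewrite /L' (linearP L) linearP.
have LC t : `|L' t| <= 1 * @projective_seminorm R X Y t.
  rewrite mul1r /L' norm_to_completion /=; apply/ler_addgt0Pr => e e0.
  have [s ts sl] := projective_norm_approx t e0.
  have Lt : L t = \sum_(xy <- [seq (U xy.1, V xy.2) | xy <- s]) tens xy.1 xy.2.
    rewrite ts linear_sum big_map /=; apply: eq_bigr => xy _; exact: LE.
  rewrite (le_trans (projective_norm_le_cost Lt))// (le_trans _ (ltW sl))//.
  rewrite /cost big_map; apply: ler_sum => xy _ /=.
  by rewrite ler_pM//; exact: contractionP.
pose L'' : {linear tensor X Y -> Z} :=
  HB.pack L' (GRing.isLinear.Build _ _ _ _ L' L'lin).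
have [F [FL FC]] := @completion_extension R _ _ Z L'' 1 ler01 LC.
exists F; split => [x y|z]; last by rewrite -[leRHS]mul1r.
by rewrite /ptens FL /= /L' LE.
Qed.

Definition tmap (U : contraction X) (V : contraction Y) : {linear Z -> Z} :=
  projT1 (cid (tmap_exists U V)).

Lemma tmap_ptens U V x y : tmap U V (ptens x y) = ptens (U x) (V y).
Proof. by rewrite /tmap; case: cid => F []. Qed.

Lemma tmap_le U V z : `|tmap U V z| <= `|z|.
Proof. by rewrite /tmap; case: cid => F []. Qed.

(** The form of tmap_le that projective_eq_on_tensors asks for. *)
Let tmap_le1 U V z : `|tmap U V z| <= 1 * `|z|.
Proof. by rewrite mul1r tmap_le. Qed.

Lemma tmap_comp (U U' U'' : contraction X) (V V' V'' : contraction Y) z :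
  (forall x, U (U' x) = U'' x) -> (forall y, V (V' y) = V'' y) ->
  tmap U V (tmap U' V' z) = tmap U'' V'' z.
Proof.
move=> UE VE.
have := @projective_eq_on_tensors (tmap U V \o tmap U' V') (tmap U'' V'') 1 1.
apply => //= [w|x y]; last by rewrite !tmap_ptens UE VE.
by rewrite mul1r (le_trans (tmap_le _ _ _))// tmap_le.
Qed.

Lemma tmap_id (U : contraction X) (V : contraction Y) z :
  (forall x, U x = x) -> (forall y, V y = y) -> tmap U V z = z.
Proof.
move=> UE VE; have := @projective_eq_on_tensors (tmap U V) idfun 1 1.
by apply => //= [w|x y]; rewrite ?mul1r// tmap_ptens UE VE.
Qed.

Lemma tmap_addl (U U' U'' : contraction X) (V : contraction Y) z :
  (forall x, U'' x = U x + U' x) -> tmap U'' V z = tmap U V z + tmap U' V z.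
Proof.
move=> UE.
have := @projective_eq_on_tensors (tmap U'' V) (tmap U V \+ tmap U' V) 1 2.
apply => //= [w|x y]; last by rewrite !tmap_ptens UE ptensDl.
rewrite (le_trans (ler_normD _ _))//.
by have := tmap_le U V w; have := tmap_le U' V w; lra.
Qed.

Lemma tmap_addr (U : contraction X) (V V' V'' : contraction Y) z :
  (forall y, V'' y = V y + V' y) -> tmap U V'' z = tmap U V z + tmap U V' z.
Proof.
move=> VE.
have := @projective_eq_on_tensors (tmap U V'') (tmap U V \+ tmap U V') 1 2.
apply => //= [w|x y]; last by rewrite !tmap_ptens VE ptensDr.
rewrite (le_trans (ler_normD _ _))//.
by have := tmap_le U V w; have := tmap_le U V' w; lra.
Qed.

Lemma tmap_cvg (U : nat -> contraction X) (V : nat -> contraction Y)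
    (U' : contraction X) (V' : contraction Y) :
  (forall x, U n x @[n --> \oo] --> U' x) ->
  (forall y, V n y @[n --> \oo] --> V' y) ->
  forall z, tmap (U n) (V n) z @[n --> \oo] --> tmap U' V' z.
Proof.
move=> Ucvg Vcvg z.
have ptens_cvg x y : ptens (U n x) (V n y) @[n --> \oo] --> ptens (U' x) (V' y).
  have lim0 : `|U' x - U n x| * `|y| + `|x| * `|V' y - V n y| @[n --> \oo]
       --> `|U' x - U' x| * `|y| + `|x| * `|V' y - V' y|.
    apply: cvgD; apply: cvgM; try exact: cvg_cst; apply: cvg_norm;
     by apply: cvgB; [exact: cvg_cst|].
  move: lim0; rewrite !subrr !normr0 mul0r mulr0 addr0 => /cvgr0Pnorm_lt lim0.
  apply/cvgrPdist_lt => e e0; apply: filterS (lim0 e e0) => n /ltr_normlW.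
  apply: le_lt_trans.
  have -> : ptens (U' x) (V' y) - ptens (U n x) (V n y) =
     ptens (U' x - U n x) (V' y) + ptens (U n x) (V' y - V n y).
    by rewrite ptensBl ptensBr addrA subrK.
  rewrite (le_trans (ler_normD _ _))// lerD//.
    by rewrite (le_trans (norm_ptens _ _))// ler_wpM2l// contractionP.
  by rewrite (le_trans (norm_ptens _ _))// ler_wpM2r// contractionP.
apply/cvgrPdist_lt => e e0; have e30 : 0 < e / 3 by rewrite divr_gt0.
have [s zs _] := ptens_dense z e30.
set w := \sum_(xy <- s) _ in zs.
have sum_cvg (r : seq (X * Y)) :
    tmap (U n) (V n) (\sum_(xy <- r) ptens xy.1 xy.2) @[n --> \oo] -->
    tmap U' V' (\sum_(xy <- r) ptens xy.1 xy.2).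
  elim: r => [|xy r IH].
    rewrite big_nil linear0; under eq_fun do rewrite linear0.
    exact: cvg_cst.
  rewrite big_cons linearD; under eq_fun do rewrite linearD tmap_ptens.
  by rewrite tmap_ptens; apply: cvgD.
have /cvgrPdist_lt/(_ _ e30) := sum_cvg s.
apply: filterS => n; rewrite -/w => nw.
have -> : e = e / 3 + (e / 3 + e / 3) by field.
rewrite (le_lt_trans (ler_distD (tmap U' V' w) _ _))// ler_ltD//.
  by rewrite -linearB (le_trans (tmap_le _ _ _))// ltW.
rewrite (le_lt_trans (ler_distD (tmap (U n) (V n) w) _ _))// ltrD//.
by rewrite -linearB (le_lt_trans (tmap_le _ _ _))// distrC.
Qed.

End projective_tensor_theory.

(** * Bases whose norms add in p-th power *)

Section powers.
Context {R : realType}.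
Implicit Types (a b p q s : R).

Lemma powR_le_imp p a b : 0 < p -> 0 <= a -> 0 <= b -> a `^ p <= b `^ p -> a <= b.
Proof.
move=> p0 a0 b0; apply: contraTT; rewrite -!ltNge => ba.
by apply: gt0_ltr_powR => //; rewrite nnegrE.
Qed.

Lemma powR_le_root p a (k : R) : 0 < p -> 0 <= a -> a `^ p <= k -> a <= k `^ p^-1.
Proof.
move=> p0 a0 ak; rewrite -[a](@powRr1 _ a)// -(mulfV (lt0r_neq0 p0)) powRrM.
have k0 : 0 <= k := le_trans (powR_ge0 _ _) ak.
by apply: ge0_ler_powR => //; rewrite ?nnegrE ?powR_ge0// invr_ge0 ltW.
Qed.

Lemma powR_sublinear s (C e : R) : s < 1 -> 0 < e ->
  exists k : nat, C * k%:R `^ s < k%:R * e.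
Proof.
move=> s1 e0; have t0 : 0 < 1 - s by rewrite subr_gt0.
pose D := (`|C| + 1) / e; have D0 : 0 < D by rewrite divr_gt0// ltr_wpDl.
exists (Num.truncn (D `^ (1 - s)^-1)).+1.
set k : R := _%:R.
have k0 : 0 < k by rewrite ltr0n.
have kD : D < k `^ (1 - s).
  have : D `^ (1 - s)^-1 < k by exact: truncnS_gt.
  move=> /(@gt0_ltr_powR _ _ t0); rewrite !nnegrE powR_ge0 ltW// => /(_ isT isT).
  by rewrite -powRrM mulVf ?gt_eqF// powRr1// ltW.
have kE : k = k `^ s * k `^ (1 - s).
  rewrite -powRD; last by rewrite (gt_eqF k0) implybT.
  by rewrite addrC subrK powRr1// ltW.
rewrite [X in _ < X * e]kE mulrC -mulrA ltr_pM2l ?powR_gt0// -ltr_pdivrMr//.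
by rewrite (le_lt_trans _ kD)// ler_pM2r ?invr_gt0// ler_wpDr// ler_norm.
Qed.

Lemma powR_div a v s : 0 <= a -> 0 < v -> (a / v) `^ s = (v `^ s)^-1 * a `^ s.
Proof.
move=> a0 v0; rewrite powRM ?invr_ge0 ?(ltW v0)// mulrC; congr (_ * _).
by rewrite -(powR_inv1 (ltW v0)) -powRrM mulN1r powRN.
Qed.

(** If c is the larger of a^p and b^q, then ab <= c^(1/p + 1/q) <= c. This crude form
    of the inequality of Young costs a factor 2 in segXY_sum, which is harmless. *)
Lemma mul_le_sum_powR p q a b : 0 < p -> 0 < q -> 1 <= p^-1 + q^-1 ->
  0 <= a <= 1 -> 0 <= b <= 1 -> a * b <= a `^ p + b `^ q.
Proof.
move=> p0 q0 pq /andP[a0 a1] /andP[b0 b1].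
pose c := Num.max (a `^ p) (b `^ q).
have ac : a <= c `^ p^-1 by apply: powR_le_root; rewrite // le_max lexx.
have bc : b <= c `^ q^-1 by apply: powR_le_root; rewrite // le_max lexx orbT.
have c0 : 0 <= c by rewrite le_max powR_ge0.
have pow_le1 (x r : R) : 0 < r -> 0 <= x <= 1 -> x `^ r <= 1.
  move=> r0 /andP[x0 x1]; have r1 : 1 `^ r = 1 :> R by rewrite powR1.
  by rewrite -[leRHS]r1; apply: ge0_ler_powR; rewrite ?nnegrE// ltW.
have c1 : c <= 1 by rewrite ge_max !pow_le1// ?a0 ?b0.
have cle : c <= a `^ p + b `^ q.
  by rewrite ge_max lerDl lerDr !powR_ge0.
apply: le_trans cle; rewrite (le_trans (ler_pM a0 b0 ac bc))//.
have [->|cn0] := eqVneq c 0.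
  by rewrite powR0 ?mul0r// invr_neq0// gt_eqF.
rewrite -powRD; last by rewrite cn0 implybT.
by rewrite -[leRHS]powRr1// ger_powR// c1 andbT lt_def cn0.
Qed.
End powers.

(** The only features of l_p that matter: a Schauder basis for which the p-th powers
    of the norms of the head and of the tail of a vector add up. *)
Record lp_basis (R : realType) (X : normedModType R) (p : R) := LpBasis {
  coef : nat -> {scalar X};
  bvec : nat -> X;
  coef_bvec : forall i j, coef i (bvec j) = (i == j)%:R;
  basis_power : forall n x, let h := \sum_(0 <= i < n) coef i x *: bvec i in
    `|x| `^ p = `|h| `^ p + `|x - h| `^ p;
  basis_cvg : forall x, \sum_(0 <= i < n) coef i x *: bvec i @[n --> \oo] --> x
}.

Section lp_basis_theory.
Context {R : realType} {X : normedModType R} {p : R}.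
Hypothesis p0 : 0 < p.
Variable b : lp_basis X p.
Implicit Types (x : X).

Definition bhead n x : X := \sum_(0 <= i < n) coef b i x *: bvec b i.

Lemma head_is_linear n : linear (bhead n).
Proof.
move=> a x y; rewrite /bhead scaler_sumr -big_split /=.
by apply: eq_bigr => i _; rewrite linearP scalerDl scalerA.
Qed.
HB.instance Definition _ n := GRing.isLinear.Build R X X _ (bhead n) (head_is_linear n).

Definition btail n x : X := x - bhead n x.

Lemma tail_is_linear n : linear (btail n).
Proof. by move=> a x y; rewrite /btail linearP scalerBr opprD addrACA. Qed.
HB.instance Definition _ n := GRing.isLinear.Build R X X _ (btail n) (tail_is_linear n).

Lemma headS n x : bhead n.+1 x = bhead n x + coef b n x *: bvec b n.
Proof. by rewrite /bhead big_nat_recr. Qed.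

Lemma head0 x : bhead 0 x = 0.
Proof. by rewrite /bhead big_geq. Qed.

Lemma head_bvec n i : bhead n (bvec b i) = if (i < n)%N then bvec b i else 0.
Proof.
elim: n => [|n IH]; first by rewrite head0.
rewrite headS IH coef_bvec ltnS (leq_eqVlt i n).
have [->|_] := eqVneq i n; first by rewrite ltnn scale1r add0r.
by rewrite scale0r addr0.
Qed.

Lemma head_head n m x : bhead n (bhead m x) = bhead (minn n m) x.
Proof.
elim: m => [|m IH]; first by rewrite minn0 !head0 linear0.
rewrite headS linearD linearZ /= IH head_bvec.
have [nm|mn] := leqP n m.
  by rewrite scaler0 addr0 (minn_idPl (leqW nm)).
by rewrite (minn_idPr mn) headS.
Qed.

Lemma head_cvg x : bhead n x @[n --> \oo] --> x.
Proof. exact: basis_cvg. Qed.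

Lemma power_split n x : `|x| `^ p = `|bhead n x| `^ p + `|btail n x| `^ p.
Proof. exact: basis_power. Qed.

Lemma head_le n x : `|bhead n x| <= `|x|.
Proof. by apply: (powR_le_imp p0) => //; rewrite (power_split n x) lerDl powR_ge0. Qed.

Lemma tail_le n x : `|btail n x| <= `|x|.
Proof. by apply: (powR_le_imp p0) => //; rewrite (power_split n x) lerDr powR_ge0. Qed.

Definition headc n := Contraction (head_le n).
Definition tailc n := Contraction (tail_le n).

Definition seg n m x : X := bhead m (btail n x).

Lemma seg_is_linear n m : linear (seg n m).
Proof. by move=> a x y; rewrite /seg !linearP. Qed.
HB.instance Definition _ n m := GRing.isLinear.Build R X X _ (seg n m) (seg_is_linear n m).

Lemma seg_le n m x : `|seg n m x| <= `|x|.
Proof. by rewrite (le_trans (head_le _ _))// tail_le. Qed.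

Definition segc n m := Contraction (seg_le n m).

Lemma head_tail n m x : bhead n (btail m x) = btail m (bhead n x).
Proof. by rewrite /btail linearB /= !head_head minnC. Qed.

Lemma head_idem n m x : (n <= m)%N -> bhead n (bhead m x) = bhead n x.
Proof. by move=> nm; rewrite head_head (minn_idPl nm). Qed.

Lemma head_idem2 n m x : (n <= m)%N -> bhead m (bhead n x) = bhead n x.
Proof. by move=> nm; rewrite head_head (minn_idPr nm). Qed.

Lemma tail_tail n m x : (n <= m)%N -> btail n (btail m x) = btail m x.
Proof.
move=> nm; rewrite /btail (linearB (bhead n)) /= head_idem//.
by rewrite subrr subr0.
Qed.

Lemma tail_tail2 n m x : (n <= m)%N -> btail m (btail n x) = btail m x.
Proof.
move=> nm; rewrite /btail (linearB (bhead m)) /= head_idem2//.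
by rewrite opprB addrA subrK.
Qed.

Lemma tail_head0 n m x : (m <= n)%N -> btail n (bhead m x) = 0.
Proof. by move=> mn; rewrite /btail head_idem2// subrr. Qed.

Lemma head_tail0 n m x : (m <= n)%N -> bhead m (btail n x) = 0.
Proof. by move=> mn; rewrite head_tail tail_head0. Qed.

Lemma tail_cvg x : btail n x @[n --> \oo] --> (0 : X).
Proof.
rewrite -(subrr x); apply: cvgB; [exact: cvg_cst|exact: head_cvg].
Qed.

Lemma seg_cvg n x : seg n m x @[m --> \oo] --> btail n x.
Proof. exact: head_cvg. Qed.

(** The term coef i x e_i is the difference of two heads of x, of norm at most
    2 |x|. *)
Lemma coef_bounded i : exists2 C, 0 <= C & forall x, `|coef b i x| <= C * `|x|.
Proof.
have b0 : 0 < `|bvec b i|.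
  rewrite normr_gt0; apply/eqP => bi0; have := coef_bvec b i i.
  by rewrite bi0 linear0 eqxx => /esym/eqP; rewrite oner_eq0.
exists (2 / `|bvec b i|) => [|x]; first by rewrite divr_ge0.
rewrite mulrAC ler_pdivlMr// -normrZ.
have -> : coef b i x *: bvec b i = bhead i.+1 x - bhead i x.
  by rewrite headS addrAC subrr add0r.
rewrite (le_trans (ler_normB _ _))// mulr_natl mulr2n.
by rewrite lerD// head_le.
Qed.

Section blocks.
Variables n m : nat -> nat.
Hypothesis nm : forall i, (n i <= m i <= n i.+1)%N.

Lemma seg_power_sum k x : \sum_(0 <= i < k) `|seg (n i) (m i) x| `^ p <= `|x| `^ p.
Proof.
suff H : \sum_(0 <= i < k) `|seg (n i) (m i) x| `^ p <= `|bhead (n k) x| `^ p.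
  rewrite (le_trans H)// ge0_ler_powR// ?nnegrE ?head_le// ltW//.
elim: k => [|k IH]; first by rewrite big_geq// powR_ge0.
have /andP[nmk mnk] := nm k; rewrite big_nat_recr//= (le_trans (lerD IH (lexx _)))//.
rewrite -(head_idem _ nmk) /seg head_tail -power_split -(head_idem _ mnk).
by rewrite ge0_ler_powR// ?nnegrE ?head_le// ltW.
Qed.

Lemma seg_sum1 k x : p = 1 -> \sum_(0 <= i < k) `|seg (n i) (m i) x| <= `|x|.
Proof.
move=> p1; have := seg_power_sum k x; rewrite p1 powRr1//.
by under eq_bigr do rewrite powRr1//.
Qed.

(** Normalize |x| = 1. A block of norm above eta is at most eta^-p times its own p-th
    power, and these powers add up to at most 1; the other blocks are at most eta
    each. So the norms of k disjoint blocks sum to o(k) |x|, uniformly in x. *)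
Lemma seg_sum_small (eta : R) k x : 0 < eta ->
  \sum_(0 <= i < k) `|seg (n i) (m i) x| <= (k%:R * eta + (eta `^ p)^-1) * `|x|.
Proof.
move=> eta0; have [->|x0] := eqVneq x 0.
  rewrite normr0 mulr0 big1// => i _; by rewrite linear0 normr0.
have nx : 0 < `|x| by rewrite normr_gt0.
have step i : `|seg (n i) (m i) x| <=
    eta * `|x| + (eta `^ p)^-1 * `|x| `^ (1 - p) * `|seg (n i) (m i) x| `^ p.
  set a := `|seg _ _ x|; have [ae|ea] := leP a (eta * `|x|).
    by rewrite ler_wpDr// !mulr_ge0 ?invr_ge0 ?powR_ge0.
  have : (eta * `|x|) `^ p <= a `^ p.
    apply: ge0_ler_powR; rewrite ?nnegrE ?normr_ge0 ?mulr_ge0 ?(ltW eta0)//.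
      exact: ltW.
    exact: ltW.
  rewrite powRM ?(ltW eta0)// => /(ler_wpM2l (powR_ge0 `|x| (1 - p))).
  rewrite mulrCA -powRD; last by rewrite (gt_eqF nx) implybT.
  rewrite subrK powRr1// => H.
  have : a <= `|x| by rewrite seg_le.
  move: H; rewrite -ler_pdivlMl ?powR_gt0// => H /le_trans /(_ H).
  rewrite mulrA => /le_trans; apply.
  by rewrite lerDr mulr_ge0// ltW.
have : \sum_(0 <= i < k) `|seg (n i) (m i) x| <= \sum_(0 <= i < k)
    (eta * `|x| + (eta `^ p)^-1 * `|x| `^ (1 - p) * `|seg (n i) (m i) x| `^ p).
  by apply: ler_sum => i _; exact: step.
move=> /le_trans; apply.
rewrite big_split /= sumr_const_nat subn0 -mulr_sumr mulrDl.
rewrite -[X in X + _]mulr_natl mulrA lerD2l.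
rewrite -mulrA ler_wpM2l ?invr_ge0 ?powR_ge0//.
apply: le_trans (ler_wpM2l (powR_ge0 _ _) (seg_power_sum k x)) _.
rewrite -powRD; last by rewrite (gt_eqF nx) implybT.
by rewrite subrK powRr1.
Qed.

End blocks.

(** Otherwise there are disjointly supported unit vectors on which g exceeds e. The sum
    of k of them has norm at most k^(1/p), while g is at least k e on it; this is
    absurd for large k as 1/p < 1. *)
Lemma functional_tail_small (g : {scalar X}) (C e : R) : 1 < p -> 0 <= C -> 0 < e ->
  (forall x, `|g x| <= C * `|x|) ->
  exists n, forall x, `|g (btail n x)| <= e * `|x|.
Proof.
move=> p1 C0 e0 gC; apply: contrapT => H.
have far n : exists m x, [/\ (n <= m)%N, `|x| <= 1 & e < g (seg n m x)].
  have [x xP] : exists x, e * `|x| < `|g (btail n x)|.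
    apply: contrapT => nx; apply: H; exists n => x.
    by rewrite leNgt; apply/negP => fx; apply: nx; exists x.
  have x0 : 0 < `|x|.
    rewrite normr_gt0; apply/eqP => x0; move: xP.
    by rewrite x0 !linear0 !normr0 mulr0 ltxx.
  pose c := Num.sg (g (btail n x)) / `|x|.
  have gc : e < g (btail n (c *: x)).
    by rewrite !linearZ /= /c mulrAC -normrEsg ltr_pdivlMr.
  have : g (seg n m (c *: x)) @[m --> \oo] --> g (btail n (c *: x)).
    apply/cvgrPdist_lt => d d0.
    have C1 : 0 < `|C| + 1 by rewrite ltr_wpDl.
    have /cvgrPdist_lt/(_ _ (divr_gt0 d0 C1)) := @seg_cvg n (c *: x).
    apply: filterS => m hm; rewrite -linearB (le_lt_trans (gC _))//.
    rewrite (le_lt_trans (ler_wpM2r (normr_ge0 _) (ler_norm C)))//.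
    move: hm; rewrite ltr_pdivlMr// => /(le_lt_trans _); apply.
    by rewrite mulrC ler_wpM2l// lerDl.
  move=> /cvgr_gt/(_ _ gc)[N _ NP]; exists (maxn n N), (c *: x); split.
  - exact: leq_maxl.
  - rewrite normrZ normrM normfV normr_id mulrVK ?unitfE ?gt_eqF//.
    by rewrite normr_sg lern1 leq_b1.
  - by apply: NP => /=; exact: leq_maxr.
have build k : exists y m, [/\ bhead m y = y, `|y| `^ p <= k%:R & k%:R * e <= g y].
  elim: k => [|k [y [m [my yk gy]]]].
    exists 0, 0%N; split; first by rewrite linear0.
      by rewrite normr0 powR0// gt_eqF.
    by rewrite linear0 mul0r.
  have [m' [x [mm' x1 gx]]] := far m.
  have hy : bhead m (y + seg m m' x) = y.
    by rewrite linearD /= my /seg head_idem// head_tail0// addr0.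
  exists (y + seg m m' x), m'; split.
  - by rewrite linearD /= -{1}my head_idem2// my /seg head_idem2.
  - rewrite (power_split m) hy -natr1 lerD//.
    rewrite /btail hy addrAC subrr add0r.
    have -> : 1 = 1 `^ p :> R by rewrite powR1.
    by rewrite ge0_ler_powR// ?nnegrE ?(ltW p0)// (le_trans (seg_le _ _ _)).
  - by rewrite linearD -natr1 mulrDl mul1r lerD// ltW.
have [k kP] : exists k : nat, C * k%:R `^ p^-1 < k%:R * e.
  by apply: powR_sublinear => //; rewrite invf_lt1.
have [y [m [_ yk gy]]] := build k.
have Ck := ler_wpM2l C0 (powR_le_root p0 (normr_ge0 _) yk).
have := le_trans gy (le_trans (ler_norm _) (le_trans (gC y) Ck)).
by move=> /(lt_le_trans kP); rewrite ltxx.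
Qed.

End lp_basis_theory.

(** * Limits along a filter, complements of projections *)

Lemma linear_bounded_cvg (R : realType) (V W : normedModType R) (L : {linear V -> W})
    (C : R) (T : Type) (F : set_system T) {FF : Filter F} (u : T -> V) (l : V) :
  (forall v, `|L v| <= C * `|v|) -> u @ F --> l -> L (u t) @[t --> F] --> L l.
Proof.
move=> LC ul; have Lc : continuous L.
  apply/linear_bounded_continuous/linear_boundedP.
  apply: filterS (nbhs_pinfty_ge (num_real C)) => r /= Cr x.
  by rewrite (le_trans (LC x))// ler_wpM2r.
by apply: continuous_cvg => //; exact: Lc.
Qed.

Lemma norm_lim_le (R : realType) (V : normedModType R) (T : Type)
    (F : set_system T) {FF : ProperFilter F} (u : T -> V) (l : V) (r : R) :
  u @ F --> l -> (\forall t \near F, `|u t| <= r) -> `|l| <= r.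
Proof.
move=> ul ur; apply/ler_addgt0Pl => e e0.
have /cvgrPdist_lt/(_ _ e0) le := ul.
have [t [/= lt ut]] := filter_ex (filterI le ur).
by rewrite -(subrK (u t) l) (le_trans (ler_normD _ _))// lerD// ltW.
Qed.

Lemma eq_lim (R : realType) (V : normedModType R) (T : Type)
    (F : set_system T) {FF : ProperFilter F} (u v : T -> V) (l k : V) :
  u @ F --> l -> v @ F --> k -> (\forall t \near F, u t = v t) -> l = k.
Proof.
move=> ul vk uv; apply/eqP; rewrite -subr_eq0 -normr_le0.
apply: (@norm_lim_le _ _ _ F _ (u - v)) => //; first exact: cvgB.
by apply: filterS uv => t E; rewrite !fctE E subrr normr0.
Qed.

Section complement.
Context {R : realType} {V : normedModType R} (T : {linear V -> V}).

Lemma complement_le v : (forall u, `|T u| <= `|u|) -> `|v - T v| <= 2 * `|v|.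
Proof.
by move=> Tle; rewrite (le_trans (ler_normB _ _))// mulr_natl mulr2n lerD2l.
Qed.

Lemma complement_idem v : (forall u, T (T u) = T u) ->
  v - T v - T (v - T v) = v - T v.
Proof. by move=> TT; rewrite linearB /= TT subrr subr0. Qed.

End complement.

(** * Tensor products of two bases *)

Section tensor_bases.
Context {R : realType} {X Y : normedModType R} {p q : R}.
Hypotheses (p0 : 0 < p) (q0 : 0 < q).
Variables (bX : lp_basis X p) (bY : lp_basis Y q).
Local Notation Z := (projective_tensor X Y).

Lemma id_le (V : normedModType R) (v : V) : `|(idfun : {linear V -> V}) v| <= `|v|.
Proof. by []. Qed.
Definition idc (V : normedModType R) := Contraction (@id_le V).

Local Notation HX := (headc p0 bX).
Local Notation HY := (headc q0 bY).
Local Notation TX := (tailc p0 bX).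
Local Notation TY := (tailc q0 bY).
Local Notation SX := (segc p0 bX).
Local Notation SY := (segc q0 bY).
Local Notation IX := (idc X).
Local Notation IY := (idc Y).

Lemma tmap_comp_le (U U' U'' : contraction X) (V V' V'' : contraction Y) (z : Z) :
  (forall x, U (U' x) = U'' x) -> (forall y, V (V' y) = V'' y) ->
  `|tmap U'' V'' z| <= `|tmap U' V' z|.
Proof. by move=> UE VE; rewrite -(tmap_comp z UE VE) tmap_le. Qed.

Lemma tmap_sum_le (U : nat -> contraction X) (V : nat -> contraction Y) c k :
  0 <= c ->
  (forall x y, \sum_(0 <= i < k) `|U i x| * `|V i y| <= c * (`|x| * `|y|)) ->
  forall z : Z, \sum_(0 <= i < k) `|tmap (U i) (V i) z| <= c * `|z|.
Proof.
move=> c0 H; apply: (@projective_le_on_tensors _ _ _ _ k%:R) => //.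
- move=> z w; rewrite -big_split /=; apply: ler_sum => i _.
  by rewrite linearD ler_normD.
- move=> z; have : \sum_(0 <= i < k) `|tmap (U i) (V i) z| <=
      \sum_(0 <= i < k) `|z| by apply: ler_sum => i _; exact: tmap_le.
  by rewrite sumr_const_nat subn0 -[X in _ <= X -> _]mulr_natl.
- move=> x y; apply: le_trans (H x y); apply: ler_sum => i _.
  by rewrite tmap_ptens norm_ptens.
Qed.

Section disjoint_blocks.
Variables n m : nat -> nat.
Hypothesis nm : forall i, (n i <= m i <= n i.+1)%N.

(** The case 1/p + 1/q >= 1: diagonal blocks add up in the l_1 sense. On an elementary
    tensor, after normalization, the norms of the blocks of x and of y are numbers in
    [0, 1] whose p-th and q-th powers sum to at most 1. *)
Lemma segXY_sum k (z : Z) : 1 <= p^-1 + q^-1 ->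
  \sum_(0 <= i < k) `|tmap (SX (n i) (m i)) (SY (n i) (m i)) z| <= 2 * `|z|.
Proof.
move=> pq; apply: tmap_sum_le => // x y.
have [->|x0] := eqVneq x 0.
  by rewrite normr0 mul0r mulr0 big1// => i _; rewrite linear0 normr0 mul0r.
have [->|y0] := eqVneq y 0.
  by rewrite normr0 !mulr0 big1// => i _; rewrite linear0 normr0 mulr0.
have nx : 0 < `|x| by rewrite normr_gt0.
have ny : 0 < `|y| by rewrite normr_gt0.
rewrite -ler_pdivrMr ?mulr_gt0// mulr_suml.
have : \sum_(0 <= i < k) (`|SX (n i) (m i) x| * `|SY (n i) (m i) y| / (`|x| * `|y|))
    <= \sum_(0 <= i < k) ((`|x| `^ p)^-1 * `|SX (n i) (m i) x| `^ p +
                          (`|y| `^ q)^-1 * `|SY (n i) (m i) y| `^ q).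
  apply: ler_sum => i _; rewrite invfM mulrACA.
  rewrite -!powR_div//.
  apply: mul_le_sum_powR => //.
    by rewrite divr_ge0//= ler_pdivrMr// mul1r seg_le.
  by rewrite divr_ge0//= ler_pdivrMr// mul1r seg_le.
move=> /le_trans; apply; rewrite big_split/= -!mulr_sumr.
have -> : 2 = 1 + 1 :> R by [].
by apply: lerD; rewrite ler_pdivrMl ?powR_gt0// mulr1 seg_power_sum.
Qed.

Lemma segX_sum1 k (z : Z) : p = 1 ->
  \sum_(0 <= i < k) `|tmap (SX (n i) (m i)) IY z| <= 2 * `|z|.
Proof.
move=> pE; apply: tmap_sum_le => // x y.
rewrite -mulr_suml /= mulrA ler_wpM2r// (le_trans (seg_sum1 p0 bX nm k x pE))//.
by rewrite mulr_natl mulr2n lerDl.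
Qed.

Lemma segY_sum1 k (z : Z) : q = 1 ->
  \sum_(0 <= i < k) `|tmap IX (SY (n i) (m i)) z| <= 2 * `|z|.
Proof.
move=> qE; apply: tmap_sum_le => // x y.
rewrite -mulr_sumr /= mulrCA ler_wpM2l// (le_trans (seg_sum1 q0 bY nm k y qE))//.
by rewrite mulr_natl mulr2n lerDl.
Qed.

Lemma segX_sum_small eta k (z : Z) : 0 < eta ->
  \sum_(0 <= i < k) `|tmap (SX (n i) (m i)) IY z| <=
  (k%:R * eta + (eta `^ p)^-1) * `|z|.
Proof.
move=> eta0; apply: tmap_sum_le => [|x y].
  by rewrite addr_ge0 ?mulr_ge0 ?invr_ge0 ?powR_ge0// ltW.
by rewrite -mulr_suml /= mulrA ler_wpM2r// seg_sum_small.
Qed.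

Lemma segY_sum_small eta k (z : Z) : 0 < eta ->
  \sum_(0 <= i < k) `|tmap IX (SY (n i) (m i)) z| <=
  (k%:R * eta + (eta `^ q)^-1) * `|z|.
Proof.
move=> eta0; apply: tmap_sum_le => [|x y].
  by rewrite addr_ge0 ?mulr_ge0 ?invr_ge0 ?powR_ge0// ltW.
by rewrite -mulr_sumr /= mulrCA ler_wpM2l// seg_sum_small.
Qed.

End disjoint_blocks.

(** * Bounded completeness *)

(** Large tails at infinitely many places would give k disjoint blocks of norm at least
    e in a single z_N, whereas their norms sum to o(k). This is stated for abstract
    functions E and T so as to serve both factors. *)
Lemma tails_become_small (E : nat -> nat -> Z -> R) (T : nat -> Z -> R) (K : R -> R)
    (z : nat -> Z) (M e : R) :
  (forall n m k, (n <= m <= k)%N -> T n (z m) <= E n m (z k)) ->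
  (forall n m : nat -> nat, (forall i, (n i <= m i <= n i.+1)%N) ->
    forall eta k w, 0 < eta ->
    \sum_(0 <= i < k) E (n i) (m i) w <= (k%:R * eta + K eta) * `|w|) ->
  (forall n, `|z n| <= M) -> 0 < e ->
  exists n, forall m, (n <= m)%N -> T n (z m) <= e.
Proof.
move=> TE Esum zM e0; apply: contrapT => H.
have /choice[f fP] n : exists m, (n <= m)%N /\ e < T n (z m).
  apply: contrapT => nm; apply: H; exists n => m nlem.
  by rewrite leNgt; apply/negP => Tn; apply: nm; exists m.
pose n i := iter i f 0%N.
have M0 : 0 <= M := le_trans (normr_ge0 _) (zM 0%N).
have nle i : (n i <= f (n i) <= n i.+1)%N by rewrite leqnn andbT; have [] := fP (n i).
have nmono i j : (i <= j)%N -> (n i <= n j)%N.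
  move=> ij; rewrite -(subnK ij); elim: (j - i)%N => // k IH.
  rewrite addSn (leq_trans IH)//; have /andP[nf fn] := nle (k + i)%N.
  exact: leq_trans nf fn.
(* With this value eta M <= e / 2, so the k e from the k blocks cannot be absorbed. *)
pose eta := e / (2 * (M + 1)).
have M1 : 0 < 2 * (M + 1) by rewrite mulr_gt0// ltr_wpDl.
have eta0 : 0 < eta by rewrite divr_gt0.
have etaM : eta * M <= e / 2.
  rewrite /eta invfM mulrA -mulrA ler_piMr ?divr_ge0 ?(ltW e0)//.
  by rewrite mulrC ler_pdivrMr ?mul1r ?lerDl// ltr_wpDl.
have bound k : k%:R * e <= k%:R * (e / 2) + `|K eta| * M.
  have lo : k%:R * e <= \sum_(0 <= i < k) E (n i) (f (n i)) (z (n k)).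
    have -> : k%:R * e = \sum_(0 <= i < k) e.
      by rewrite sumr_const_nat subn0 mulr_natl.
    apply: ler_sum_nat => i /andP[_ ik]; have [nf Tn] := fP (n i).
    by rewrite (le_trans (ltW Tn))// TE// nf (nmono i.+1).
  have := le_trans lo (Esum n (f \o n) nle eta k (z (n k)) eta0).
  move=> /le_trans; apply.
  apply: (@le_trans _ _ ((k%:R * eta + `|K eta|) * M)).
    apply: (@le_trans _ _ ((k%:R * eta + `|K eta|) * `|z (n k)|)).
      by rewrite ler_wpM2r// lerD2l ler_norm.
    by rewrite ler_wpM2l// addr_ge0// mulr_ge0// ltW.
  by rewrite mulrDl -mulrA lerD2r ler_wpM2l.
pose k := (Num.truncn (`|K eta| * M / (e / 2))).+1.
have : `|K eta| * M / (e / 2) < k%:R by exact: truncnS_gt.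
rewrite ltr_pdivrMr ?divr_gt0//; have := bound k.
rewrite {1}[e]splitr mulrDr lerD2l => h1 h2.
by have := le_lt_trans h1 h2; rewrite ltxx.
Qed.

Lemma tmap0l (U : contraction X) (V : contraction Y) (z : Z) :
  (forall x, U x = 0) -> tmap U V z = 0.
Proof.
move=> U0; apply: (addrI (tmap U V z)); rewrite addr0.
by rewrite -(@tmap_addl _ _ _ U U U)// => x; rewrite U0 addr0.
Qed.

Lemma tmap0r (U : contraction X) (V : contraction Y) (z : Z) :
  (forall y, V y = 0) -> tmap U V z = 0.
Proof.
move=> V0; apply: (addrI (tmap U V z)); rewrite addr0.
by rewrite -(@tmap_addr _ _ _ U V V V)// => y; rewrite V0 addr0.
Qed.

Lemma corner_remainder n (z : Z) :
  z - tmap (HX n) (HY n) z = tmap IX (TY n) z + tmap (TX n) (HY n) z.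
Proof.
rewrite -{1}(@tmap_id _ _ _ IX IY z)//.
rewrite (@tmap_addr _ _ _ IX (HY n) (TY n) IY); last by move=> y; rewrite addrC subrK.
rewrite (@tmap_addl _ _ _ (HX n) (TX n) IX (HY n)); last by move=> x; rewrite addrC subrK.
by rewrite -[X in X - _]addrA addrAC subrr add0r addrC.
Qed.

(** A bounded family of compatible corners converges. The block estimate is applied to
    one tensor factor at a time, with the identity on the other one; the two resulting
    tails bound z m - z n by corner_remainder. *)
Theorem bounded_complete (z : nat -> Z) (M : R) : (forall n, `|z n| <= M) ->
  (forall n m, (n <= m)%N -> tmap (HX n) (HY n) (z m) = z n) ->
  cvg (z @ \oo).
Proof.
move=> zM zcons.
have smallX e : 0 < e -> exists n, forall m, (n <= m)%N ->
    `|tmap (TX n) IY (z m)| <= e.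
  apply: (tails_become_small (E := fun n m w => `|tmap (SX n m) IY w|)
    (T := fun n w => `|tmap (TX n) IY w|) (K := fun eta => (eta `^ p)^-1) _ _ zM).
    move=> n m k /andP[nm mk]; rewrite -(zcons m k mk).
    rewrite (@tmap_comp _ _ _ _ _ (SX n m) _ _ (HY m))//; last first.
      by move=> x; rewrite /= /seg head_tail.
    by apply: (tmap_comp_le (U := IX) (V := HY m)).
  by move=> n m nm eta k w eta0; exact: segX_sum_small.
have smallY e : 0 < e -> exists n, forall m, (n <= m)%N ->
    `|tmap IX (TY n) (z m)| <= e.
  apply: (tails_become_small (E := fun n m w => `|tmap IX (SY n m) w|)
    (T := fun n w => `|tmap IX (TY n) w|) (K := fun eta => (eta `^ q)^-1) _ _ zM).
    move=> n m k /andP[nm mk]; rewrite -(zcons m k mk).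
    rewrite (@tmap_comp _ _ _ _ _ (HX m) _ _ (SY n m))//; last first.
      by move=> x; rewrite /= /seg head_tail.
    by apply: (tmap_comp_le (U := HX m) (V := IY)).
  by move=> n m nm eta k w eta0; exact: segY_sum_small.
apply/cauchy_cvgP/cauchyP => e e0; have e40 : 0 < e / 4 by rewrite divr_gt0.
have [n1 n1P] := smallX _ e40; have [n2 n2P] := smallY _ e40.
pose n := maxn n1 n2; exists (z n), n => // m /= nm.
have n1n : (n1 <= n)%N := leq_maxl _ _; have n2n : (n2 <= n)%N := leq_maxr _ _.
rewrite -ball_normE /= distrC -(zcons n m nm) corner_remainder.
rewrite (le_lt_trans (ler_normD _ _))//.
have H1 : `|tmap IX (TY n) (z m)| <= e / 4.
  apply: le_trans (n2P m (leq_trans n2n nm)).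
  by apply: (tmap_comp_le (U := IX) (V := TY n)) => // y; exact: tail_tail2.
have H2 : `|tmap (TX n) (HY n) (z m)| <= e / 4.
  apply: le_trans (n1P m (leq_trans n1n nm)).
  by apply: (tmap_comp_le (U := TX n) (V := HY n)) => // x; exact: tail_tail2.
by rewrite (le_lt_trans (lerD H1 H2))//; lra.
Qed.

(** * Weak compactness of balls in ranges of projections *)

Lemma ultra_bounded_cvg (T : Type) (F : set_system T) (g : T -> R) (D : R) :
  UltraFilter F -> F [set t | `|g t| <= D] -> exists a : R, g @ F --> a.
Proof.
move=> FU FD.
have FI : (g @ F) `[- D, D]%classic.
  rewrite /fmap /=; apply: (@filterS _ F _ _ _ _ FD) => t /= gt.
  by rewrite in_itv/= -ler_norml.
have [a [_ gcl]] := @segment_compact R (- D) D (g @ F) _ FI.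
exists a; apply/cvgrPdistC_lt => e e0.
have [//|FC] := in_ultra_setVsetC [set t | `|g t - a| < e] FU.
have [r [/= re]] := gcl [set x | ~ `|x - a| < e] _ FC (nbhsx_ballx a e e0).
by rewrite -ball_normE /= distrC.
Qed.

Lemma sum_bounded (I : Type) (s : seq I) (g : I -> Z -> Z) :
  (forall i, exists C, forall u, `|g i u| <= C * `|u|) ->
  exists C, forall u, `|\sum_(i <- s) g i u| <= C * `|u|.
Proof.
move=> gb; elim: s => [|i s [C IH]].
  by exists 0 => u; rewrite big_nil normr0 mul0r.
have [D gD] := gb i; exists (D + C) => u.
by rewrite big_cons mulrDl (le_trans (ler_normD _ _))// lerD.
Qed.

Lemma corner_coordinates n (w : Z) (k : nat -> nat -> continuous_dual Z) :
  (forall i j x y, k i j (ptens x y) = coef bX i x * coef bY j y) ->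
  tmap (HX n) (HY n) w =
  \sum_(0 <= i < n) \sum_(0 <= j < n) k i j w *: ptens (bvec bX i) (bvec bY j).
Proof.
move=> kE; pose G (w : Z) :=
  \sum_(0 <= i < n) \sum_(0 <= j < n) k i j w *: ptens (bvec bX i) (bvec bY j).
have Glin : linear G.
  move=> a u v; rewrite /G scaler_sumr -big_split /=; apply: eq_bigr => i _.
  rewrite scaler_sumr -big_split /=; apply: eq_bigr => j _.
  by rewrite linearP scalerDl scalerA.
pose G' : {linear Z -> Z} := HB.pack G (GRing.isLinear.Build _ _ _ _ G Glin).
have [C GC] : exists C, forall u, `|G u| <= C * `|u|.
  apply: sum_bounded => i; apply: sum_bounded => j.
  have [K K0 kK] := dual_bounded (k i j).
  exists (K * `|ptens (bvec bX i) (bvec bY j)|) => u.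
  by rewrite normrZ mulrAC ler_wpM2r.
apply: (@projective_eq_on_tensors _ _ _ (tmap (HX n) (HY n)) G' 1 C) => //.
  by move=> u; rewrite mul1r tmap_le.
move=> x y; rewrite tmap_ptens /= /G /bhead.
rewrite (big_morph (ptens^~ _) (fun x x' => ptensDl x x' _) (ptens0l _)).
apply: eq_bigr => i _; rewrite (big_morph (ptens _) (ptensDr _) (ptens0r _)).
by apply: eq_bigr => j _; rewrite kE ptensZl ptensZr scalerA.
Qed.

(** Along an ultrafilter the coordinates converge, so the corners converge in norm to
    compatible tensors z n of norm at most r. By bounded_complete these converge to
    some l. The last hypothesis says that each functional nearly factors through a
    corner, uniformly on the set, and turns convergence of corners into weak
    convergence to l. *)
Theorem weakly_compact_fixed_ball (A : {linear Z -> Z}) (C r : R) :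
  (forall z, `|A z| <= C * `|z|) ->
  (forall n z, A (tmap (HX n) (HY n) z) = tmap (HX n) (HY n) (A z)) ->
  (forall (f : continuous_dual Z) e, 0 < e -> exists N, forall n, (N <= n)%N ->
     forall z, A z = z -> `|f (z - tmap (HX n) (HY n) z)| <= e * `|z|) ->
  weakly_compact [set z : Z | `|z| <= r /\ A z = z].
Proof.
move=> AC AR Af; rewrite /weakly_compact compact_ultra => F FU FS.
have FF : ProperFilter F by exact: ultra_proper.
have r0 : 0 <= r.
  by have [z [zr _]] := filter_ex FS; exact: le_trans (normr_ge0 _) zr.
have /choice[k kE] i : exists k : nat -> continuous_dual Z,
    forall j x y, k j (ptens x y) = coef bX i x * coef bY j y.
  have [Ci Ci0 CiP] := coef_bounded p0 bX i.
  suff /choice[k kP] j : exists f : continuous_dual Z,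
      forall x y, f (ptens x y) = coef bX i x * coef bY j y by exists k.
  have [Cj Cj0 CjP] := coef_bounded q0 bY j.
  apply: (@projective_functional _ _ _ _ (Ci * Cj)).
  - exact: mulr_ge0.
  - by move=> y a x x'; rewrite linearP mulrDl mulrA.
  - by move=> x a y y'; rewrite linearP mulrDr /= mulrCA.
  - by move=> x y; rewrite normrM mulrACA ler_pM.
have /choice[a aP] i : exists a : nat -> R, forall j, k i j z @[z --> F] --> a j.
  suff /choice[a ?] j : exists a : R, k i j z @[z --> F] --> a by exists a.
  have [D D0 kD] := dual_bounded (k i j).
  apply: (@ultra_bounded_cvg _ _ _ (D * r)); apply: filterS FS => z [zr _] /=.
  by rewrite (le_trans (kD z))// ler_wpM2l// ltW.
pose z n := \sum_(0 <= i < n) \sum_(0 <= j < n)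
  a i j *: ptens (bvec bX i) (bvec bY j).
have Rz n : tmap (HX n) (HY n) w @[w --> F] --> z n.
  under eq_fun do rewrite (corner_coordinates _ _ kE).
  apply: cvg_big => [|i _]; first exact: add_continuous.
  apply: cvg_big => [|j _]; first exact: add_continuous.
  exact: cvgZr_tmp (aP i j).
have zr n : `|z n| <= r.
  apply: norm_lim_le (Rz n) _; apply: filterS FS => w [wr _].
  exact: le_trans (tmap_le _ _ _) wr.
have RC n w : `|tmap (HX n) (HY n) w| <= 1 * `|w| by rewrite mul1r tmap_le.
have zcons n m : (n <= m)%N -> tmap (HX n) (HY n) (z m) = z n.
  move=> nm; apply: eq_lim (linear_bounded_cvg (RC n) (Rz m)) (Rz n) _.
  apply: nearW => w; apply: tmap_comp => v; exact: head_idem.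
have Az n : A (z n) = z n.
  apply: eq_lim (linear_bounded_cvg AC (Rz n)) (Rz n) _.
  by apply: filterS FS => w [_ Aw]; rewrite AR Aw.
have /cvg_ex[l zl] := bounded_complete zr zcons.
have lr : `|l| <= r by apply: norm_lim_le zl _; exact: nearW.
have Al : A l = l.
  by apply: eq_lim (linear_bounded_cvg AC zl) zl _; exact: nearW.
have Rl n : tmap (HX n) (HY n) l = z n.
  apply: (eq_lim (linear_bounded_cvg (RC n) zl) (cvg_cst (z n))).
  by exists n => // m /= nm; exact: zcons.
exists l; split => //.
apply/(@weak_cvgP R Z F l) => f; apply/cvgrPdist_lt => e e0.
have e30 : 0 < e / 3 by rewrite divr_gt0.
have r1 : 0 < r + 1 by rewrite ltr_wpDl.
have [n nP] := Af f _ (divr_gt0 e30 r1).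
have {}nP w : `|w| <= r -> A w = w -> `|f (w - tmap (HX n) (HY n) w)| < e / 3.
  move=> wr Aw; rewrite (le_lt_trans (nP n _ _ Aw))// mulrAC ltr_pdivrMr//.
  by rewrite ltr_pM2l// (le_lt_trans wr)// ltrDl.
have [D D0 fD] := dual_bounded f.
have /cvgrPdist_lt/(_ _ (divr_gt0 e30 D0)) := Rz n.
apply: filterS2 FS => w [wr Aw] zw.
have h1 := nP _ lr Al; rewrite Rl in h1; have h2 := nP w wr Aw.
have h3 : `|f (z n - tmap (HX n) (HY n) w)| < e / 3.
  by rewrite (le_lt_trans (fD _))// mulrC -ltr_pdivlMr.
have -> : f l - f w = f (l - z n) + f (z n - tmap (HX n) (HY n) w)
    - f (w - tmap (HX n) (HY n) w).
  by rewrite !(linearB f) opprB !addrA !subrK.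
rewrite (le_lt_trans (ler_normB _ _))//.
have h4 := le_lt_trans (ler_normD _ _) (ltrD h1 h3).
have := ltrD h4 h2.
by have -> : e / 3 + e / 3 + e / 3 = e by field.
Qed.

(** * Functionals on the tensor product of two bases *)

Lemma functional_le_on_tensors (f : continuous_dual Z) (U : contraction X)
    (V : contraction Y) (e : R) : 0 <= e ->
  (forall x y, `|f (ptens (U x) (V y))| <= e * (`|x| * `|y|)) ->
  forall z, `|f (tmap U V z)| <= e * `|z|.
Proof.
move=> e0 fe; have [D D0 fD] := dual_bounded f.
apply: (@projective_le_on_tensors _ _ _ _ D) => //.
- by move=> z w; rewrite !linearD ler_normD.
- by move=> z; rewrite (le_trans (fD _))// ler_wpM2l ?tmap_le// ltW.
- by move=> x y; rewrite tmap_ptens.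
Qed.

(** Pitt's theorem for bilinear forms. Otherwise there are disjointly supported pairs of
    unit vectors (u_i, v_i) with f (u_i (x) v_i) > e. With suitable signs t_i, chosen
    one after the other so that the cross terms help, f is at least k e on
    (sum t_i u_i) (x) (sum t_i v_i), whose norm is at most k^(1/p + 1/q) = o(k). *)
Theorem functional_corner_tail_small (f : continuous_dual Z) (e : R) :
  p^-1 + q^-1 < 1 -> 0 < e ->
  exists n, forall z, `|f (tmap (TX n) (TY n) z)| <= e * `|z|.
Proof.
move=> pq e0; apply: contrapT => H.
have far n : exists m x y, [/\ (n <= m)%N, `|x| <= 1, `|y| <= 1 &
    e < f (ptens (SX n m x) (SY n m y))].
  have [x [y xyP]] : exists x y, e * (`|x| * `|y|) < `|f (ptens (TX n x) (TY n y))|.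
    apply: contrapT => nxy; apply: H; exists n.
    apply: functional_le_on_tensors => [|x y]; first exact: ltW.
    by rewrite leNgt; apply/negP => fxy; apply: nxy; exists x, y.
  have x0 : 0 < `|x|.
    rewrite normr_gt0; apply/eqP => x0; move: xyP.
    by rewrite x0 linear0 ptens0l linear0 !normr0 mul0r mulr0 ltxx.
  have y0 : 0 < `|y|.
    rewrite normr_gt0; apply/eqP => y0; move: xyP.
    by rewrite y0 linear0 ptens0r linear0 !normr0 !mulr0 ltxx.
  pose s := f (ptens (TX n x) (TY n y)).
  (* Normalized, with the sign put on x so that f takes a positive value. *)
  pose x' := (Num.sg s / `|x|) *: x; pose y' := `|y|^-1 *: y.
  have gc : e < f (tmap (TX n) (TY n) (ptens x' y')).
    rewrite tmap_ptens /x' /y' !linearZ ptensZl ptensZr !linearZ /= -/s.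
    have -> : Num.sg s / `|x| * (`|y|^-1 * s) = `|s| / (`|x| * `|y|).
      by rewrite normrEsg invfM; ring.
    by rewrite ltr_pdivlMr// mulr_gt0.
  have : f (tmap (SX n m) (SY n m) (ptens x' y')) @[m --> \oo] -->
      f (tmap (TX n) (TY n) (ptens x' y')).
    apply: continuous_cvg; first exact: dual_continuous.
    by apply: tmap_cvg => v; exact: seg_cvg.
  move=> /cvgr_gt/(_ _ gc)[N _ NP]; exists (maxn n N), x', y'; split.
  - exact: leq_maxl.
  - rewrite normrZ normrM normfV normr_id mulrVK ?unitfE ?gt_eqF//.
    by rewrite normr_sg lern1 leq_b1.
  - by rewrite normrZ normfV normr_id mulVf// gt_eqF.
  - by rewrite -tmap_ptens; apply: NP => /=; exact: leq_maxr.
have build k : exists x y m, [/\ bhead bX m x = x /\ bhead bY m y = y,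
    `|x| `^ p <= k%:R, `|y| `^ q <= k%:R & k%:R * e <= f (ptens x y)].
  elim: k => [|k [x [y [m [[mx my] xk yk fxy]]]]].
    exists 0, 0, 0%N; split; first by rewrite !linear0.
    - by rewrite normr0 powR0// gt_eqF.
    - by rewrite normr0 powR0// gt_eqF.
    - by rewrite ptens0l linear0 mul0r.
  have [m' [u [v [mm' u1 v1 fuv]]]] := far m.
  (* The sign for which the cross terms of the bilinear form are nonnegative. *)
  have [t [t1 tt tS]] : exists t : R, [/\ `|t| = 1, t * t = 1 &
      0 <= t * (f (ptens x (SY m m' v)) + f (ptens (SX m m' u) y))].
    have [S0|S0] := leP 0 (f (ptens x (SY m m' v)) + f (ptens (SX m m' u) y)).
      by exists 1; rewrite normr1 !mul1r.
    by exists (-1); rewrite normrN1 mulrNN !mul1r mulN1r oppr_ge0 ltW.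
  have hx : bhead bX m (x + t *: SX m m' u) = x.
    by rewrite linearD linearZ /= mx /seg head_idem// head_tail0// scaler0 addr0.
  have hy : bhead bY m (y + t *: SY m m' v) = y.
    by rewrite linearD linearZ /= my /seg head_idem// head_tail0// scaler0 addr0.
  exists (x + t *: SX m m' u), (y + t *: SY m m' v), m'; split.
  - rewrite !linearD !linearZ /= -{1}mx -{1}my !head_idem2// mx my.
    by split.
  - rewrite (power_split bX m) hx -natr1 lerD//.
    rewrite /btail hx addrAC subrr add0r normrZ t1 mul1r.
    have -> : 1 = 1 `^ p :> R by rewrite powR1.
    by rewrite ge0_ler_powR// ?nnegrE ?(ltW p0)// (le_trans (contractionP _ _)).
  - rewrite (power_split bY m) hy -natr1 lerD//.
    rewrite /btail hy addrAC subrr add0r normrZ t1 mul1r.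
    have -> : 1 = 1 `^ q :> R by rewrite powR1.
    by rewrite ge0_ler_powR// ?nnegrE ?(ltW q0)// (le_trans (contractionP _ _)).
  - have -> : f (ptens (x + t *: SX m m' u) (y + t *: SY m m' v)) =
        f (ptens x y) +
        t * (f (ptens x (SY m m' v)) + f (ptens (SX m m' u) y)) +
        t * t * f (ptens (SX m m' u) (SY m m' v)).
      by rewrite ptensDl !ptensDr !ptensZl !ptensZr !linearD !linearZ /=; ring.
    rewrite tt mul1r -natr1 mulrDl mul1r lerD//; last exact: ltW.
    by rewrite ler_wpDr.
have [C C0 fC] := dual_bounded f.
have [k kP] : exists k : nat, C * k%:R `^ (p^-1 + q^-1) < k%:R * e.
  exact: powR_sublinear.
have [x [y [m [_ xk yk fxy]]]] := build k.
have le1 : k%:R * e <= C * (k%:R `^ p^-1 * k%:R `^ q^-1).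
  rewrite (le_trans fxy)// (le_trans (ler_norm _))// (le_trans (fC _))//.
  rewrite ler_wpM2l ?(ltW C0)// (le_trans (norm_ptens _ _))//.
  by rewrite ler_pM// powR_le_root.
have := lt_le_trans kP le1; rewrite -powRD ?ltxx//.
by rewrite gt_eqF// addr_gt0// invr_gt0.
Qed.

(** Induction on j reduces this to the functionals y |-> f (e_j (x) y). *)
Lemma functional_row_tail_small (f : continuous_dual Z) (j : nat) (e : R) :
  1 < q -> 0 < e -> exists N, forall n, (N <= n)%N ->
  forall z, `|f (tmap (HX j) (TY n) z)| <= e * `|z|.
Proof.
move=> q1 e0.
suff [N NP] : exists N, forall x y,
    `|f (ptens (HX j x) (TY N y))| <= e * (`|x| * `|y|).
  exists N => n Nn z.
  rewrite -(@tmap_comp _ _ _ (HX j) IX (HX j) (TY N) (TY n) (TY n) z)//; last first.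
    by move=> y; exact: tail_tail.
  rewrite (le_trans (functional_le_on_tensors (ltW e0) NP _))//.
  by rewrite ler_wpM2l ?tmap_le// ltW.
elim: j e e0 => [|j IH] e e0.
  exists 0%N => x y; rewrite /= head0 ptens0l linear0 normr0.
  by rewrite !mulr_ge0// ltW.
have e20 : 0 < e / 2 by rewrite divr_gt0.
have [N1 N1P] := IH _ e20.
have [K K0 KP] := coef_bounded p0 bX j.
have K1 : 0 < K + 1 by rewrite ltr_wpDl.
have [D D0 fD] := dual_bounded f.
pose g y := f (ptens (bvec bX j) y).
have glin : scalar g by move=> a y y'; rewrite /g ptens_linearr linearP.
pose g' : {scalar Y} := HB.pack g (GRing.isLinear.Build _ _ _ _ g glin).
have gC y : `|g' y| <= D * `|bvec bX j| * `|y|.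
  by rewrite (le_trans (fD _))// -mulrA ler_wpM2l ?(ltW D0)// norm_ptens.
have [|N2 N2P] := functional_tail_small q0 bY q1 _ (divr_gt0 e20 K1) gC.
  by rewrite mulr_ge0// ltW.
exists (maxn N1 N2) => x y /=; set N := maxn N1 N2.
rewrite headS ptensDl ptensZl linearD linearZ /=.
rewrite (le_trans (ler_normD _ _))// [X in _ <= X * _]splitr mulrDl lerD//.
  rewrite -(tail_tail (p := q) bY _ (leq_maxl N1 N2)) (le_trans (N1P _ _))//.
  by rewrite ler_wpM2l ?(ltW e20)// ler_wpM2l// tail_le.
rewrite normrM -(tail_tail (p := q) bY _ (leq_maxr N1 N2)).
have := ler_pM (normr_ge0 _) (normr_ge0 _) (KP x) (N2P (btail bY N y)).
move=> /le_trans; apply.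
have le1 : K * (e / 2 / (K + 1)) <= e / 2.
  by rewrite mulrCA ler_piMr ?(ltW e20)// ler_pdivrMr// mul1r lerDl.
rewrite mulrACA (le_trans (ler_wpM2r (mulr_ge0 (normr_ge0 _) (normr_ge0 _)) le1))//.
rewrite ler_wpM2l ?(ltW e20)//.
by rewrite ler_wpM2l// tail_le.
Qed.

Lemma functional_col_tail_small (f : continuous_dual Z) (j : nat) (e : R) :
  1 < p -> 0 < e -> exists N, forall n, (N <= n)%N ->
  forall z, `|f (tmap (TX n) (HY j) z)| <= e * `|z|.
Proof.
move=> p1 e0.
suff [N NP] : exists N, forall x y,
    `|f (ptens (TX N x) (HY j y))| <= e * (`|x| * `|y|).
  exists N => n Nn z.
  rewrite -(@tmap_comp _ _ _ (TX N) (TX n) (TX n) (HY j) IY (HY j) z)//; last first.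
    by move=> y; exact: tail_tail.
  rewrite (le_trans (functional_le_on_tensors (ltW e0) NP _))//.
  by rewrite ler_wpM2l ?tmap_le// ltW.
elim: j e e0 => [|j IH] e e0.
  exists 0%N => x y; rewrite /= head0 ptens0r linear0 normr0.
  by rewrite !mulr_ge0// ltW.
have e20 : 0 < e / 2 by rewrite divr_gt0.
have [N1 N1P] := IH _ e20.
have [K K0 KP] := coef_bounded q0 bY j.
have K1 : 0 < K + 1 by rewrite ltr_wpDl.
have [D D0 fD] := dual_bounded f.
pose g x := f (ptens x (bvec bY j)).
have glin : scalar g by move=> a x x'; rewrite /g ptens_linearl linearP.
pose g' : {scalar X} := HB.pack g (GRing.isLinear.Build _ _ _ _ g glin).
have gC x : `|g' x| <= D * `|bvec bY j| * `|x|.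
  rewrite (le_trans (fD _))// -mulrA ler_wpM2l ?(ltW D0)//.
  by rewrite mulrC norm_ptens.
have [|N2 N2P] := functional_tail_small p0 bX p1 _ (divr_gt0 e20 K1) gC.
  by rewrite mulr_ge0// ltW.
exists (maxn N1 N2) => x y /=; set N := maxn N1 N2.
rewrite headS ptensDr ptensZr linearD linearZ /=.
rewrite (le_trans (ler_normD _ _))// [X in _ <= X * _]splitr mulrDl lerD//.
  rewrite -(tail_tail (p := p) bX _ (leq_maxl N1 N2)) (le_trans (N1P _ _))//.
  by rewrite ler_wpM2l ?(ltW e20)// ler_wpM2r// tail_le.
rewrite normrM -(tail_tail (p := p) bX _ (leq_maxr N1 N2)).
have := ler_pM (normr_ge0 _) (normr_ge0 _) (KP y) (N2P (btail bX N x)).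
move=> /le_trans; apply.
have le1 : K * (e / 2 / (K + 1)) <= e / 2.
  by rewrite mulrCA ler_piMr ?(ltW e20)// ler_pdivrMr// mul1r lerDl.
rewrite mulrACA (le_trans (ler_wpM2r (mulr_ge0 (normr_ge0 _) (normr_ge0 _)) le1))//.
rewrite ler_wpM2l ?(ltW e20)//.
by rewrite mulrC ler_wpM2r// tail_le.
Qed.

Lemma tmap_comm (U U' : contraction X) (V V' : contraction Y) (z : Z) :
  (forall x, U (U' x) = U' (U x)) -> (forall y, V (V' y) = V' (V y)) ->
  tmap U V (tmap U' V' z) = tmap U' V' (tmap U V z).
Proof.
move=> UE VE.
have := @projective_eq_on_tensors _ _ _ (tmap U V \o tmap U' V')
  (tmap U' V' \o tmap U V) 1 1.
apply => //= [w|w|x y]; last by rewrite !tmap_ptens UE VE.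
  by rewrite mul1r (le_trans (tmap_le _ _ _))// tmap_le.
by rewrite mul1r (le_trans (tmap_le _ _ _))// tmap_le.
Qed.

Lemma headC (V : normedModType R) (s : R) (b : lp_basis V s) n m v :
  bhead b n (bhead b m v) = bhead b m (bhead b n v).
Proof. by rewrite !head_head minnC. Qed.

Section remainder.
Variables j n : nat.
Hypothesis jn : (j <= n)%N.

(** The remainder consists of j rows, j columns, and a part that factors through the
    tail of both factors; the three are small for three different reasons. *)
Lemma corner_remainder_split (z : Z) : z - tmap (HX n) (HY n) z =
  tmap (HX j) (TY n) z + tmap (TX n) (HY j) z +
  (tmap (TX j) (TY n) z + tmap (TX n) (SY j n) z).
Proof.
rewrite corner_remainder.
rewrite (@tmap_addl _ _ _ (HX j) (TX j) IX (TY n)); last first.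
  by move=> x; rewrite /= /btail addrC subrK.
rewrite (@tmap_addr _ _ _ (TX n) (HY j) (SY j n) (HY n)); first exact: addrACA.
by move=> y; rewrite /= /seg /btail linearB /= head_idem2// addrC subrK.
Qed.

Lemma corner_remainder_tail0 (z : Z) : tmap (TX j) (TY j) z = 0 ->
  z - tmap (HX n) (HY n) z = tmap (HX j) (TY n) z + tmap (TX n) (HY j) z.
Proof.
move=> z0; rewrite corner_remainder_split.
rewrite -(@tmap_comp _ _ _ (TX j) (TX j) (TX j) (TY n) (TY j) (TY n) z); first last.
- by move=> y; exact: tail_tail2.
- by move=> x; exact: tail_tail2.
rewrite -(@tmap_comp _ _ _ (TX n) (TX j) (TX n) (SY j n) (TY j) (SY j n) z); first last.
- by move=> y; rewrite /= /seg tail_tail2.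
- by move=> x; exact: tail_tail2.
by rewrite z0 !linear0 !addr0.
Qed.

End remainder.

Lemma weakly_compact_ball (r : R) : 1 < p -> 1 < q -> p^-1 + q^-1 < 1 ->
  weakly_compact [set z : Z | `|z| <= r /\ (idfun : {linear Z -> Z}) z = z].
Proof.
move=> p1 q1 pq; apply: (@weakly_compact_fixed_ball _ 1).
- by move=> z; rewrite mul1r.
- by [].
move=> f e e0; have e40 : 0 < e / 4 by rewrite divr_gt0.
have [j jP] := functional_corner_tail_small f pq e40.
have [N1 N1P] := functional_row_tail_small f j q1 e40.
have [N2 N2P] := functional_col_tail_small f j p1 e40.
exists (maxn j (maxn N1 N2)) => n; rewrite !geq_max => /and3P[jn N1n N2n] z _.
rewrite (corner_remainder_split jn) !linearD.
have h1 := N1P n N1n z; have h2 := N2P n N2n z.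
have h3 : `|f (tmap (TX j) (TY n) z)| <= e / 4 * `|z|.
  rewrite -(@tmap_comp _ _ _ (TX j) IX (TX j) (TY j) (TY n) (TY n) z)//; last first.
    by move=> y; exact: tail_tail.
  by rewrite (le_trans (jP _))// ler_wpM2l ?tmap_le// ltW.
have h4 : `|f (tmap (TX n) (SY j n) z)| <= e / 4 * `|z|.
  rewrite -(@tmap_comp _ _ _ (TX j) (TX n) (TX n) (TY j) (HY n) (SY j n) z); first last.
  - by move=> y; rewrite /= /seg head_tail.
  - by move=> x; exact: tail_tail.
  by rewrite (le_trans (jP _))// ler_wpM2l ?tmap_le// ltW.
rewrite (le_trans (ler_normD _ _))//.
have h12 := le_trans (ler_normD _ _) (lerD h1 h2).
have h34 := le_trans (ler_normD _ _) (lerD h3 h4).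
have eE (t : R) : e * t = e / 4 * t + e / 4 * t + (e / 4 * t + e / 4 * t) by field.
by rewrite eE lerD.
Qed.

(** The projection onto the first j rows together with the first j columns. *)
Definition cross_part j : {linear Z -> Z} := idfun \- tmap (TX j) (TY j).

Lemma cross_partE j z : cross_part j z = z - tmap (TX j) (TY j) z.
Proof. by []. Qed.

Lemma tmap_tail_idem j (z : Z) :
  tmap (TX j) (TY j) (tmap (TX j) (TY j) z) = tmap (TX j) (TY j) z.
Proof. by apply: tmap_comp => v; exact: tail_tail. Qed.

Lemma weakly_compact_cross (j : nat) (r : R) : 1 < p -> 1 < q ->
  weakly_compact [set z : Z | `|z| <= r /\ cross_part j z = z].
Proof.
move=> p1 q1; apply: (@weakly_compact_fixed_ball _ 2).
- by move=> z; apply: complement_le => u; exact: tmap_le.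
- move=> n z; rewrite !cross_partE linearB; congr (_ - _).
  by apply: tmap_comm => v; rewrite /= head_tail.
move=> f e e0; have e20 : 0 < e / 2 by rewrite divr_gt0.
have [N1 N1P] := functional_row_tail_small f j q1 e20.
have [N2 N2P] := functional_col_tail_small f j p1 e20.
exists (maxn j (maxn N1 N2)) => n; rewrite !geq_max => /and3P[jn N1n N2n] z.
rewrite cross_partE => /eqP; rewrite -subr_eq0 addrAC subrr add0r oppr_eq0 => /eqP z0.
rewrite (corner_remainder_tail0 jn z0) linearD (le_trans (ler_normD _ _))//.
by rewrite (splitr e) mulrDl lerD// ?N1P// N2P.
Qed.

Lemma weakly_compact_rows (j : nat) (r : R) : 1 < q ->
  weakly_compact [set z : Z | `|z| <= r /\ tmap (HX j) IY z = z].
Proof.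
move=> q1; apply: (@weakly_compact_fixed_ball _ 1).
- by move=> z; rewrite mul1r tmap_le.
- by move=> n z; apply: tmap_comm => v //; exact: headC.
move=> f e e0; have [N NP] := functional_row_tail_small f j q1 e0.
exists (maxn j N) => n; rewrite !geq_max => /andP[jn Nn] z zE.
have tail0 m (V : contraction Y) : (j <= m)%N -> tmap (TX m) V z = 0.
  move=> jm; rewrite -zE (@tmap_comp _ _ _ (TX m) (HX j) (HX 0) V IY V)//.
    by apply: tmap0l => x; exact: head0.
  by move=> x; rewrite /= tail_head0// head0.
by rewrite (corner_remainder_tail0 jn (tail0 _ _ _))// tail0// addr0 NP.
Qed.

Lemma weakly_compact_cols (j : nat) (r : R) : 1 < p ->
  weakly_compact [set z : Z | `|z| <= r /\ tmap IX (HY j) z = z].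
Proof.
move=> p1; apply: (@weakly_compact_fixed_ball _ 1).
- by move=> z; rewrite mul1r tmap_le.
- by move=> n z; apply: tmap_comm => v //; exact: headC.
move=> f e e0; have [N NP] := functional_col_tail_small f j p1 e0.
exists (maxn j N) => n; rewrite !geq_max => /andP[jn Nn] z zE.
have tail0 m (U : contraction X) : (j <= m)%N -> tmap U (TY m) z = 0.
  move=> jm; rewrite -zE (@tmap_comp _ _ _ U IX U (TY m) (HY j) (HY 0))//.
    by apply: tmap0r => y; exact: head0.
  by move=> y; rewrite /= tail_head0// head0.
by rewrite (corner_remainder_tail0 jn (tail0 _ _ _))// tail0// add0r NP.
Qed.

Lemma weakly_compact_corner (j : nat) (r : R) :
  weakly_compact [set z : Z | `|z| <= r /\ tmap (HX j) (HY j) z = z].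
Proof.
apply: (@weakly_compact_fixed_ball _ 1).
- by move=> z; rewrite mul1r tmap_le.
- by move=> n z; apply: tmap_comm => v //; exact: headC.
move=> f e e0; exists j => n jn z zE.
have -> : tmap (HX n) (HY n) z = z.
  rewrite -{1}zE (@tmap_comp _ _ _ _ _ (HX j) _ _ (HY j))// => v;
    exact: head_idem2.
by rewrite subrr linear0 normr0 mulr_ge0// ltW.
Qed.

(** * Strong weak compact generation *)

Lemma weakly_compact_small_XY (K : set Z) (e : R) : 1 <= p^-1 + q^-1 ->
  weakly_compact K -> 0 < e ->
  exists N, forall z, K z -> `|tmap (TX N) (TY N) z| <= e.
Proof.
move=> pq; apply: (@weakly_compact_small_tails _ _ (fun n => tmap (TX n) (TY n))
  (fun n m => tmap (SX n m) (SY n m))).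
- move=> z; rewrite -(@tmap0l (HX 0) (HY 0) z); last by move=> x; exact: head0.
  by apply: tmap_cvg => v; rewrite /= head0; exact: tail_cvg.
- by move=> n z; apply: tmap_cvg => v; exact: seg_cvg.
- by move=> m n k z mn nk; apply: tmap_comp => v; rewrite /= /seg tail_tail2.
- by move=> n m nm k z; exact: segXY_sum.
Qed.

Lemma weakly_compact_small_X (K : set Z) (e : R) : p = 1 ->
  weakly_compact K -> 0 < e ->
  exists N, forall z, K z -> `|tmap (TX N) IY z| <= e.
Proof.
move=> p1; apply: (@weakly_compact_small_tails _ _ (fun n => tmap (TX n) IY)
  (fun n m => tmap (SX n m) IY)).
- move=> z; rewrite -(@tmap0l (HX 0) IY z); last by move=> x; exact: head0.
  apply: tmap_cvg => v; last exact: cvg_cst.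
  by rewrite /= head0; exact: tail_cvg.
- by move=> n z; apply: tmap_cvg => v; [exact: seg_cvg|exact: cvg_cst].
- by move=> m n k z mn nk; apply: tmap_comp => v //; rewrite /= /seg tail_tail2.
- by move=> n m nm k z; exact: segX_sum1.
Qed.

Lemma weakly_compact_small_Y (K : set Z) (e : R) : q = 1 ->
  weakly_compact K -> 0 < e ->
  exists N, forall z, K z -> `|tmap IX (TY N) z| <= e.
Proof.
move=> q1; apply: (@weakly_compact_small_tails _ _ (fun n => tmap IX (TY n))
  (fun n m => tmap IX (SY n m))).
- move=> z; rewrite -(@tmap0r IX (HY 0) z); last by move=> y; exact: head0.
  apply: tmap_cvg => v; first exact: cvg_cst.
  by rewrite /= head0; exact: tail_cvg.
- by move=> n z; apply: tmap_cvg => v; [exact: cvg_cst|exact: seg_cvg].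
- by move=> m n k z mn nk; apply: tmap_comp => v //; rewrite /= /seg tail_tail2.
- by move=> n m nm k z; exact: segY_sum1.
Qed.

(** Four cases. If 1/p + 1/q < 1 the space is reflexive. If p, q > 1 and
    1/p + 1/q >= 1, use the cross-shaped projections. If an exponent is 1, the
    corresponding tail is uniformly small on weakly compact sets, and heads in that
    factor suffice. *)
Theorem SWCG_lp_bases : 1 <= p -> 1 <= q -> SWCG (projective_tensor X Y).
Proof.
move=> p1 q1.
have [pq|pq] := ltP (p^-1 + q^-1) 1.
  have p1' : 1 < p.
    rewrite -invf_lt1//; apply: lt_trans pq; by rewrite ltrDl invr_gt0.
  have q1' : 1 < q.
    rewrite -invf_lt1//; apply: lt_trans pq; by rewrite ltrDr invr_gt0.
  apply: (@SWCG_of_projections _ _ (fun=> idfun : {linear Z -> Z}) 1) => //.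
  - by move=> m z; rewrite mul1r.
  - by move=> m r _; exact: weakly_compact_ball.
  - move=> K e _ e0; exists 0%N => z _.
    by rewrite /= subrr normr0 ltW.
move: p1; rewrite le_eqVlt => /predU1P[/esym p1|p1];
  move: q1; rewrite le_eqVlt => /predU1P[/esym q1|q1].
- apply: (@SWCG_of_projections _ _ (fun m => tmap (HX m) (HY m)) 1) => //.
  + by move=> m z; rewrite mul1r tmap_le.
  + by move=> m z; apply: tmap_comp => v; exact: head_idem.
  + by move=> m r _; exact: weakly_compact_corner.
  + move=> K e cK e0; have e20 : 0 < e / 2 by rewrite divr_gt0.
    have [N1 N1P] := weakly_compact_small_X p1 cK e20.
    have [N2 N2P] := weakly_compact_small_Y q1 cK e20.
    exists (maxn N1 N2) => z Kz; rewrite corner_remainder.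
    rewrite (le_trans (ler_normD _ _))// (splitr e) lerD//.
      apply: le_trans (N2P z Kz); apply: (tmap_comp_le (U := IX) (V := TY (maxn N1 N2))) => // y.
      exact: tail_tail2 (leq_maxr _ _).
    apply: le_trans (N1P z Kz).
    apply: (tmap_comp_le (U := TX (maxn N1 N2)) (V := HY (maxn N1 N2))) => // x.
    exact: tail_tail2 (leq_maxl _ _).
- apply: (@SWCG_of_projections _ _ (fun m => tmap (HX m) IY) 1) => //.
  + by move=> m z; rewrite mul1r tmap_le.
  + by move=> m z; apply: tmap_comp => v //; exact: head_idem.
  + by move=> m r _; exact: weakly_compact_rows.
  + move=> K e cK e0; have [N NP] := weakly_compact_small_X p1 cK e0.
    exists N => z Kz; apply: le_trans (NP z Kz).
    rewrite -{1}(@tmap_id _ _ _ IX IY z)//.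
    rewrite (@tmap_addl _ _ _ (HX N) (TX N) IX IY).
      by rewrite addrAC subrr add0r.
    by move=> x; rewrite /= /btail addrC subrK.
- apply: (@SWCG_of_projections _ _ (fun m => tmap IX (HY m)) 1) => //.
  + by move=> m z; rewrite mul1r tmap_le.
  + by move=> m z; apply: tmap_comp => v //; exact: head_idem.
  + by move=> m r _; exact: weakly_compact_cols.
  + move=> K e cK e0; have [N NP] := weakly_compact_small_Y q1 cK e0.
    exists N => z Kz; apply: le_trans (NP z Kz).
    rewrite -{1}(@tmap_id _ _ _ IX IY z)//.
    rewrite (@tmap_addr _ _ _ IX (HY N) (TY N) IY).
      by rewrite addrAC subrr add0r.
    by move=> y; rewrite /= /btail addrC subrK.
- apply: (@SWCG_of_projections _ _ cross_part 2) => //.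
  + by move=> m z; apply: complement_le => u; exact: tmap_le.
  + by move=> m z; apply: complement_idem => u; exact: tmap_tail_idem.
  + by move=> m r _; exact: weakly_compact_cross.
  + move=> K e cK e0; have [N NP] := weakly_compact_small_XY pq cK e0.
    by exists N => z Kz; rewrite cross_partE subKr NP.
Qed.

End tensor_bases.

(** * The unit vectors of l_p *)

Section ellp_basis.
Context {R : realType} {p : R} (p1 : 1 <= p).
Local Notation mu := (counting : {measure set nat -> \bar R}).
Implicit Types (x : ellp p1).

Let p0 : 0 < p. Proof. exact: lt_le_trans p1. Qed.

Definition ellp_coef (i : nat) x : R := (x : nat -> R) i.

Arguments ellp_coef : simpl never.

Lemma ellp_coef_scalar i : scalar (ellp_coef i).
Proof. by []. Qed.
HB.instance Definition _ i :=
  GRing.isLinear.Build R (ellp p1) R _ (ellp_coef i) (ellp_coef_scalar i).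

Lemma ellp_unit_mem (j : nat) : (fun k => (k == j)%:R : R) \in Lfun mu p%:E.
Proof.
rewrite ellp_memE// (@nneseries_split _ _ 0 j.+1)//.
rewrite eseries0 => [|k jk _]; last first.
  rewrite add0n in jk; rewrite (gtn_eqF jk) normr0 powR0// gt_eqF//.
by rewrite adde0 sumEFin ltry.
Qed.

Definition ellp_unit (j : nat) : ellp p1 := Lfun_Sub _ (ellp_unit_mem j).

Arguments ellp_unit : simpl never.

Lemma ellp_coef_unit i j : ellp_coef i (ellp_unit j) = (i == j)%:R.
Proof. by []. Qed.

Lemma ellp_power_cvg x :
  \sum_(0 <= k < n) `|ellp_coef k x| `^ p @[n --> \oo] --> `|x| `^ p.
Proof.
have x_ge0 k : (0 <= (`|(x : nat -> R) k| `^ p)%:E)%E by rewrite lee_fin powR_ge0.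
have E : (`|x| `^ p)%:E = (\sum_(k <oo) (`|(x : nat -> R) k| `^ p)%:E)%E.
  rewrite -poweR_EFin ellp_normEsum -poweRrM mulVf ?gt_eqF// poweRe1//.
  by apply: nneseries_ge0 => k _ _.
have : (\sum_(0 <= k < n) (`|(x : nat -> R) k| `^ p)%:E)%E @[n --> \oo] -->
    (`|x| `^ p)%:E.
  by rewrite E; apply: is_cvg_nneseries => k _ _.
under eq_fun do rewrite sumEFin.
by move=> /fine_cvgP[].
Qed.

Lemma coef_head n x i : ellp_coef i (\sum_(0 <= k < n) ellp_coef k x *: ellp_unit k) =
  if (i < n)%N then ellp_coef i x else 0.
Proof.
elim: n => [|n IH]; first by rewrite big_geq.
rewrite big_nat_recr//= addrC.
rewrite ellp_coef_scalar IH ellp_coef_unit ltnS (leq_eqVlt i n).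
have [->|_] := eqVneq i n; first by rewrite ltnn mulr1 addr0.
by rewrite mulr0 add0r.
Qed.

Lemma ellp_basis_power n x (h := \sum_(0 <= i < n) ellp_coef i x *: ellp_unit i) :
  `|x| `^ p = `|h| `^ p + `|x - h| `^ p.
Proof.
have E : (fun N => \sum_(0 <= k < N) `|ellp_coef k x| `^ p) =
  (fun N => \sum_(0 <= k < N) `|ellp_coef k h| `^ p) +
  (fun N => \sum_(0 <= k < N) `|ellp_coef k (x - h)| `^ p).
  apply/funext => N; rewrite fctE -big_split /=; apply: eq_bigr => k _.
  rewrite (linearB (ellp_coef k)) /= coef_head; case: ifP => _.
    by rewrite subrr normr0 powR0 ?addr0// gt_eqF.
  by rewrite subr0 normr0 powR0 ?add0r// gt_eqF.
have hc := cvgD (@ellp_power_cvg h) (@ellp_power_cvg (x - h)).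
rewrite -E in hc; rewrite -(cvg_lim _ (@ellp_power_cvg x))//.
by apply: cvg_lim; [exact: Rhausdorff|exact: hc].
Qed.

Lemma norm_head_power n x :
  `|\sum_(0 <= i < n) ellp_coef i x *: ellp_unit i| `^ p =
  \sum_(0 <= k < n) `|ellp_coef k x| `^ p.
Proof.
set h := \sum_(0 <= i < n) _ *: _.
rewrite -(cvg_lim _ (@ellp_power_cvg h))//; apply: cvg_lim => //.
apply: cvg_near_cst; exists n => // N /= nN.
rewrite (big_cat_nat (n := n))//= [X in _ + X]big1_seq ?addr0.
  by apply: eq_big_nat => k /andP[_ kn]; rewrite coef_head kn.
move=> k /andP[_]; rewrite mem_index_iota => /andP[nk _].
by rewrite coef_head ltnNge nk normr0 powR0// gt_eqF.
Qed.

Lemma ellp_basis_cvg x :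
  \sum_(0 <= i < n) ellp_coef i x *: ellp_unit i @[n --> \oo] --> x.
Proof.
apply/cvgrPdist_lt => e e0.
have /cvgrPdist_lt/(_ (e `^ p)) := @ellp_power_cvg x.
rewrite powR_gt0// => /(_ isT); apply: filterS => n.
rewrite -norm_head_power (ellp_basis_power n x) addrC addKr => xp.
rewrite ltNge; apply/negP => ex; move: xp; apply/negP; rewrite -leNgt.
rewrite ger0_norm ?powR_ge0//; by apply: ge0_ler_powR; rewrite ?nnegrE ?normr_ge0// ltW.
Qed.

Definition ellp_basis : lp_basis (ellp p1) p :=
  @LpBasis R (ellp p1) p (fun i => ellp_coef i : {scalar ellp p1}) ellp_unit
    ellp_coef_unit ellp_basis_power ellp_basis_cvg.

End ellp_basis.

Theorem corollary3p10 (R : realType) (p1 p2 : R)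
    (hp1 : 1 <= p1) (hp2 : 1 <= p2) :
  SWCG (projective_tensor (ellp hp1) (ellp hp2)).
Proof.
exact: (SWCG_lp_bases (lt_le_trans ltr01 hp1) (lt_le_trans ltr01 hp2)
  (ellp_basis hp1) (ellp_basis hp2) hp1 hp2).
Qed.
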